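(* Let $a<b$ be real numbers, $\Omega=(a,b)$, and $\lambda\in\mathbb{C}\setminus[-1,1]$. Let $0<\alpha\le1$, let $u\in C^{\alpha}([a,b])$, and suppose that $u$ is a solution of the singular integral equation $$ \lambda u(x) - \mathrm{p.v.}\!\int_{\Omega}\frac{u(y)}{i\pi(x-y)}dy = f(x)\,,\quad x\in\Omega\,, $$ with right hand side $f$. For every positive integer $N$ such that $M:=N(b-a)$ is a positive integer, set $h=\frac1N$, $\omega^N=\{1,\dots,M\}$, $x_j=a+(j-\tfrac12)h$, let $U^N=(u_k)_{k\in\omega^N}$ be the solution of the discrete system $$ \lambda u_{j} - \frac1{i\pi N}\sum_{n\in\omega^{N},\,n\ne j}\frac{u_{n}}{x_{j}-x_{n}}= f(x_{j})\,,\quad j\in\omega^{N}\,, $$ and let $u^{N}=\sum_{k\in\omega^{N}}u_{k}\chi_{k}$ be the corresponding piecewise constant function, where $\chi_k$ is the characteristic function of the interval $I_k=[x_k-\frac h2,x_k+\frac h2]$. Then there is a constant $C$ independent of $N$ such that, for all such $N$, the error $e^{N}=u-u^{N}$ satisfies $$ \|e^{N}\|_{L^{2}(a,b)} \le C\,\big(N^{-\alpha}\log N + N^{-\frac12}\big)\,. $$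
   Context: $C^\alpha([a,b])$ is the space of complex-valued functions that are H\''older continuous of exponent $\alpha$ on $[a,b]$ (Lipschitz when $\alpha=1$). The notation $\mathrm{p.v.}\int$ denotes the Cauchy principal value integral, i.e. $\lim_{\varepsilon\to0+}\int_{\{y\in\Omega:\,|y-x|>\varepsilon\}}$. The points $x_j$ are the midpoints of the $M$ subintervals of length $h$ dividing $(a,b)$; this choice of mesh (with $b-a$ a multiple of $h$) is a standing assumption. *)

(* Defs.v *)
From mathcomp Require Import all_boot all_order all_algebra complex.
From mathcomp Require Import all_classical all_reals all_analysis.

Set Implicit Arguments.
Unset Strict Implicit.
Unset Printing Implicit Defensive.

Import Order.TTheory GRing.Theory Num.Theory.
Import numFieldNormedType.Exports.

Local Open Scope classical_set_scope.
Local Open Scope ring_scope.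
Local Open Scope complex_scope.

(* The complex modulus as an element of R (`|z| itself has type R[i]). *)
Notation cmod := (@ComplexField.Normc.normc _).

(* For alpha = 1 this is the Lipschitz condition, since t `^ 1 = t for
   t >= 0; u is only constrained on [a, b]. *)
Definition hoelder_on (R : realType) (alpha a b : R) (u : R -> R[i]) : Prop :=
  exists K : R, forall x y : R, x \in `[a, b] -> y \in `[a, b] ->
    cmod (u x - u y) <= K * `|x - y| `^ alpha.

Definition Cintegral (R : realType) (D : set R) (g : R -> R[i]) : R[i] :=
  (\int[lebesgue_measure]_(y in D) complex.Re (g y))
  +i* (\int[lebesgue_measure]_(y in D) complex.Im (g y)).

(* v is the principal value at x of the integral of g over D: the integrals
   over D with the eps-neighbourhood of x removed converge to v.  The cast
   to R[i]^o selects the usual topology of the complex numbers. *)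
Definition is_pv (R : realType) (D : set R) (x : R) (g : R -> R[i])
    (v : R[i]) : Prop :=
  Cintegral [set y | D y /\ eps < `|y - x|] g @[eps --> 0^'+] --> (v : R[i]^o).

Definition is_sie_solution (R : realType) (a b : R) (lambda : R[i])
    (f u : R -> R[i]) : Prop :=
  forall x : R, x \in `]a, b[ -> exists v : R[i],
    is_pv `]a, b[ x (fun y => u y / ('i%C * pi%:C * (x - y)%:C)) v /\
    lambda * u x - v = f x.

Definition mesh_step (R : realType) (N : nat) : R := N%:R^-1.

(* An ordinal j : 'I_M, counted from 0, stands for the index j.+1 of
   {1, ..., M}; hence midpoint a N j is x_(j+1) = a + (j + 1 - 1/2) h. *)
Definition midpoint (R : realType) (a : R) (N M : nat) (j : 'I_M) : R :=
  a + (j.+1%:R - 2^-1) * mesh_step R N.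

Definition is_discrete_solution (R : realType) (a : R) (lambda : R[i])
    (f : R -> R[i]) (N M : nat) (U : 'cV[R[i]]_M) : Prop :=
  forall j : 'I_M,
    lambda * U j 0
    - ('i%C * pi%:C * N%:R)^-1
      * (\sum_(n < M | n != j) U n 0 / (midpoint a N j - midpoint a N n)%:C)
    = f (midpoint a N j).

Definition mesh_cell (R : realType) (a : R) (N M : nat) (k : 'I_M) : set R :=
  `[midpoint a N k - mesh_step R N / 2, midpoint a N k + mesh_step R N / 2]%classic.

Definition piecewise_constant (R : realType) (a : R) (N M : nat)
    (U : 'cV[R[i]]_M) (x : R) : R[i] :=
  \sum_(k < M) U k 0 * (\1_(mesh_cell a N k) x)%:C.

Definition L2norm (R : realType) (a b : R) (e : R -> R[i]) : \bar R :=
  Lnorm lebesgue_measure 2%:E ((fun x => (cmod (e x))%:E) \_ `]a, b[).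

(* Main.v *)
(* The matrix T with entries 1/(i pi (j - n)), j != n, is a section of the
   Toeplitz operator with symbol (pi - t)/pi on (0, 2 pi), so Hilbert's
   inequality with its sharp constant pi puts its numerical range in [-1, 1].
   Hence lambda - T is invertible with inverse bounded by
   1/dist(lambda, [-1, 1]), uniformly in the size, and the l2 error at the
   midpoints is controlled by the l2 norm of the quadrature error.  At x_j the
   latter is the sum of
   - the Hoelder part: O(h^alpha/|j - n|) from the n-th cell and O(h^alpha) from
     the j-th one, which adds up to O(h^alpha log M);
   - u(x_j) times the quadrature error for the kernel 1/(x_j - y) itself.  That
     integral is ln((j - 1/2)/(M - j + 1/2)) and its discretisation is a
     difference of harmonic sums, so the error is O(1/j + 1/(M - j + 1)), whose
     l2 norm over j stays bounded: after scaling by sqrt h it yields N^(-1/2). *)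
Require Import Defs.
From mathcomp Require Import all_boot all_order all_algebra complex.
From mathcomp Require Import all_classical all_reals all_analysis.
From mathcomp Require Import measurable_realfun ring lra zify.

Import Order.TTheory GRing.Theory Num.Theory.
Import numFieldNormedType.Exports.

Local Open Scope classical_set_scope.
Local Open Scope ring_scope.
Local Open Scope complex_scope.

(** * Hilbert's inequality *)

(** What shapes the consistency half is that the quadrature error of the kernel is not small cell by
    cell. The kernel 1/(x - y) is invariant under scaling, so the cells nearest to x each contribute
    an amount independent of h, and a sum of absolute values would not tend to 0. On each side of x
    the accumulated error approaches the same limit, minus Euler's constant, and only the difference
    of the two sides is small. The coefficient u(x) is therefore kept in front of exact logarithms
    up to the point where both sides meet. The principal value adds a second cancellation. All
    integrals are truncated at a distance e < h/2 from x and bounded independently of e; the terms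
    ln e of the two sides cancel, and the limit is taken last. For stability the constant pi in
    Hilbert's inequality must be sharp, as lambda may lie arbitrarily close to [-1, 1]. The weight
    t, nonnegative on a period, gives one sign; conjugating the coefficients gives the other. *)

Lemma is_derive_bigsum (R : realType) (n : nat) (h : 'I_n -> R -> R) (x : R)
    (dh : 'I_n -> R) : (forall i, is_derive x 1 (h i) (dh i)) ->
  is_derive x 1 (fun t => \sum_(i < n) h i t) (\sum_(i < n) dh i).
Proof.
move=> H; rewrite (_ : (fun t => _) = \sum_(i < n) h i).
  exact: is_derive_sum.
by apply/funext => t; rewrite fct_sumE.
Qed.

Lemma is_derive_sin_lin (R : realType) (d t : R) :
  is_derive t 1 (fun s => sin (d * s)) (cos (d * t) * d).
Proof.
apply: (@is_derive1_comp _ (@sin R) (fun s => d * s)).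
have -> : (fun s : R => d * s) = d \*: (@id R) by [].
by apply: is_derive_eq; rewrite /GRing.scale /= mulr1.
Qed.

Lemma is_derive_cos_lin (R : realType) (d t : R) :
  is_derive t 1 (fun s => cos (d * s)) (- sin (d * t) * d).
Proof.
apply: (@is_derive1_comp _ (@cos R) (fun s => d * s)).
have -> : (fun s : R => d * s) = d \*: (@id R) by [].
by apply: is_derive_eq; rewrite /GRing.scale /= mulr1.
Qed.

(** Antiderivative of one term in the expansion of t |P(t)|^2 for a trigonometric polynomial P. The
    frequency [d = 0] needs its own branch, because division by zero returns 0 and the general
    formula would vanish there. *)
Definition trig_primitive {R : realType} (c s d t : R) : R :=
  if d == 0 then c / 2 * t ^+ 2 else
  c * (t * sin (d * t) / d + cos (d * t) / d ^+ 2)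
  + s * (- (t * cos (d * t)) / d + sin (d * t) / d ^+ 2).

Lemma is_derive_trig_primitive (R : realType) (c s d t : R) :
  is_derive t 1 (trig_primitive c s d)
    (t * (c * cos (d * t) + s * sin (d * t))).
Proof.
have [d0|d0] := eqVneq d 0.
  rewrite (_ : trig_primitive c s d = (c / 2) \*: ((@id R) * (@id R))); last first.
    by apply/funext => x; rewrite /trig_primitive d0 eqxx.
  apply: is_derive_eq; rewrite d0 mul0r cos0 sin0 /GRing.scale /=.
  by field.
have S := is_derive_sin_lin R d t; have C := is_derive_cos_lin R d t.
set fs := (fun s => sin (d * s)) in S; set fc := (fun s => cos (d * s)) in C.
rewrite (_ : trig_primitive c s d =
    c \*: (d^-1 \*: ((@id R) * fs) + (d ^- 2) \*: fc)
    + s \*: (- d^-1 \*: ((@id R) * fc) + (d ^- 2) \*: fs)); last first.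
  apply/funext => x; rewrite /trig_primitive (negbTE d0).
  transitivity (c * (d^-1 * (x * sin (d * x)) + d ^- 2 * cos (d * x))
    + s * (- d^-1 * (x * cos (d * x)) + d ^- 2 * sin (d * x))); last by [].
  by field.
apply: is_derive_eq; rewrite /GRing.scale /= /fs /fc /=.
by field.
Qed.

Lemma cos_natB (R : realType) (j n : nat) :
  cos ((j%:R - n%:R) * (pi *+ 2)) = 1 :> R /\
  sin ((j%:R - n%:R) * (pi *+ 2)) = 0 :> R.
Proof.
have H (m : nat) : cos (m%:R * (pi *+ 2)) = 1 :> R /\
    sin (m%:R * (pi *+ 2)) = 0 :> R.
  elim: m => [|m [IHc IHs]]; first by rewrite mul0r cos0 sin0.
  rewrite -natr1 mulrDl mul1r.
  rewrite (cosD _ (pi *+ 2)) (sinD _ (pi *+ 2)) IHc IHs cos2pi sin2pi.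
  by rewrite !mul0r !mulr0 mul1r subr0 addr0.
have [cj sj] := H j; have [cn sn] := H n.
by rewrite mulrBl cosB sinB cj sj cn sn !mul0r !mulr0 mul1r subr0 addr0.
Qed.

(** For a nonzero integer frequency, sine and cosine agree at both ends of the period, so only the
    boundary term [t * cos (d * t) / d] survives. This is how the kernel 1/(j - n) arises; the
    diagonal supplies the sum of squares. *)
Lemma trig_primitive_period (R : realType) (c s : R) (j n : nat) :
  let d := j%:R - n%:R in
  trig_primitive c s d (pi *+ 2) - trig_primitive c s d 0 =
  if j == n then c * 2 * pi ^+ 2 else - (pi *+ 2) * (s / d).
Proof.
have [C S] := cos_natB R j n.
rewrite /= /trig_primitive subr_eq0 eqr_nat; case: eqVneq => [|jn].
  by move=> ?; field.
have d0 : j%:R - n%:R != 0 :> R by rewrite subr_eq0 eqr_nat.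
rewrite C S !mulr0 cos0 sin0.
by field.
Qed.

(** Renaming the indices changes the sign of the odd kernel. A symmetric [g] thus gives zero, and
    the two halves of an antisymmetric one coincide. *)
Lemma sum_antisym (R : realType) (M : nat) (g : 'I_M -> 'I_M -> R) :
  \sum_(j < M) \sum_(n < M | n != j) g j n / (j%:R - n%:R)
  = - \sum_(j < M) \sum_(n < M | n != j) g n j / (j%:R - n%:R).
Proof.
rewrite (exchange_big_dep predT) //= -sumrN; apply: eq_bigr => j _.
rewrite -sumrN; apply: eq_big => [n|n nj]; first by rewrite eq_sym.
by rewrite -[X in _ / X]opprB invrN mulrN.
Qed.

(* Nonnegativity over a period of [t |P(t)|^2], where
   [P(t) = sum_j (p_j + i q_j) e^(ijt)]. *)
Lemma hilbert_le (R : realType) (M : nat) (p q : 'I_M -> R) :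
  - (\sum_(j < M) \sum_(n < M | n != j) q j * p n / (j%:R - n%:R)) *+ 2
  <= pi * \sum_(j < M) (p j ^+ 2 + q j ^+ 2).
Proof.
pose c (j n : 'I_M) := p j * p n + q j * q n.
pose s (j n : 'I_M) := p j * q n - q j * p n.
pose F t := \sum_(j < M) \sum_(n < M) trig_primitive (c j n) (s j n) (j%:R - n%:R) t.
pose dF t := \sum_(j < M) \sum_(n < M)
   (t * (c j n * cos ((j%:R - n%:R) * t) + s j n * sin ((j%:R - n%:R) * t))).
have HF (t : R) : is_derive t 1 F (dF t).
  apply: is_derive_bigsum => j; apply: is_derive_bigsum => n.
  exact: is_derive_trig_primitive.
have dF0 t : 0 <= t -> 0 <= dF t.
  move=> t0.
  (* Real and imaginary parts of the sum of [(p j + i q j) e^(ijt)]; the double sum [dF t] is [t]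
     times its squared modulus. *)
  pose P := \sum_(j < M) (p j * cos (j%:R * t) - q j * sin (j%:R * t)).
  pose Q := \sum_(j < M) (p j * sin (j%:R * t) + q j * cos (j%:R * t)).
  suff -> : dF t = t * (P ^+ 2 + Q ^+ 2).
    by rewrite mulr_ge0// addr_ge0// sqr_ge0.
  rewrite !expr2 /P /Q !mulr_suml -big_split /= mulr_sumr.
  apply: eq_bigr => j _.
  rewrite !mulr_sumr -big_split /= mulr_sumr.
  apply: eq_bigr => n _.
  by rewrite mulrBl cosB sinB /c /s; ring.
(* The mean value theorem for the explicit primitive [F] takes the place of integrating the
   nonnegative function [dF]. *)
have F_le : F 0 <= F (pi *+ 2).
  have pi0 : 0 <= pi *+ 2 :> R by rewrite mulrn_wge0// pi_ge0.
  have cF : {within `[0, pi *+ 2], continuous F}.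
    by apply: derivable_within_continuous => t _; have [] := HF t.
  have [x /[!in_itv] /= /andP[x0 _] E] := MVT_segment pi0 (fun t _ => HF t) cF.
  by rewrite -subr_ge0 E mulr_ge0// ?dF0// subr0.
(* The diagonal gives [2 * pi ^+ 2] times the sum of squares, and the off-diagonal part carries the
   factor [2 * pi]; dividing by it leaves the sharp constant [pi]. *)
have FE : F (pi *+ 2) - F 0 = pi *+ 2 * (pi * (\sum_(j < M) (p j ^+ 2 + q j ^+ 2))
    + (\sum_(j < M) \sum_(n < M | n != j) q j * p n / (j%:R - n%:R)) *+ 2).
  rewrite /F -sumrB.
  under eq_bigr => j _.
    rewrite -sumrB (bigD1 j) //= trig_primitive_period eqxx.
    under eq_bigr => n nj.
      rewrite trig_primitive_period /= val_eqE eq_sym (negbTE nj).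
      over.
    over.
  rewrite big_split /=.
  have -> : \sum_(i < M) c i i * 2 * pi ^+ 2
      = pi *+ 2 * (pi * \sum_(j < M) (p j ^+ 2 + q j ^+ 2)).
    by rewrite !mulr_sumr; apply: eq_bigr => i _; rewrite /c; ring.
  rewrite mulrDr; congr (_ + _).
  under eq_bigr => j _ do rewrite -mulr_sumr.
  rewrite -mulr_sumr mulNr -mulrN; congr (_ * _).
  have SE : \sum_(j < M) \sum_(n < M | n != j) p j * q n / (j%:R - n%:R)
      = - \sum_(j < M) \sum_(n < M | n != j) q j * p n / (j%:R - n%:R) :> R.
    rewrite (@sum_antisym R M (fun j n => p j * q n)); congr (- _).
    by do 2 (apply: eq_bigr => ? _); rewrite (mulrC (p _)).
  have -> : \sum_(j < M) \sum_(n < M | n != j) s j n / (j%:R - n%:R)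
      = \sum_(j < M) \sum_(n < M | n != j) p j * q n / (j%:R - n%:R)
      - \sum_(j < M) \sum_(n < M | n != j) q j * p n / (j%:R - n%:R).
    rewrite -sumrB; apply: eq_bigr => j _; rewrite -sumrB; apply: eq_bigr => n _.
    by rewrite /s mulrBl.
  by rewrite SE -opprD opprK mulr2n.
have pi2 : 0 < pi *+ 2 :> R by rewrite mulrn_wgt0// pi_gt0.
move: F_le; rewrite -subr_ge0 FE pmulr_rge0//.
by lra.
Qed.

(** Replacing [q] by [- q], that is conjugating the coefficients, flips the bilinear sum and keeps
    the squares; this yields the other sign. *)
Lemma hilbert_inequality (R : realType) (M : nat) (p q : 'I_M -> R) :
  `|(\sum_(j < M) \sum_(n < M | n != j) q j * p n / (j%:R - n%:R)) *+ 2|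
  <= pi * \sum_(j < M) (p j ^+ 2 + q j ^+ 2).
Proof.
rewrite ler_norml; apply/andP; split.
  by have := @hilbert_le R M p q; rewrite lerNl mulNrn.
have := @hilbert_le R M p (fun j => - q j).
under eq_bigr => j _ do under eq_bigr => n _ do rewrite !mulNr.
under [in leRHS]eq_bigr => j _ do rewrite sqrrN.
by under eq_bigr => j _ do rewrite sumrN; rewrite sumrN opprK.
Qed.

(** * Stability of the discrete operator *)

(** Since x_j - x_n = (j - n)/N, the factor 1/N of the quadrature cancels. The operator depends on
    the mesh only through its size [M], which is why stability is uniform in [N]. *)
Definition discrete_op {R : realType} (lambda : R[i]) {M : nat}
    (E : 'I_M -> R[i]) (j : 'I_M) : R[i] :=
  lambda * E j - ('i%C * pi%:C)^-1
    * \sum_(n < M | n != j) E n / (j%:R - n%:R)%:C.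

Lemma normc_sqr (R : realType) (z : R[i]) :
  cmod z ^+ 2 = complex.Re z ^+ 2 + complex.Im z ^+ 2.
Proof. by case: z => x y /=; rewrite sqr_sqrtr// addr_ge0// sqr_ge0. Qed.

Lemma normc_ge0 (R : realType) (z : R[i]) : 0 <= cmod z.
Proof. by case: z => x y /=; rewrite sqrtr_ge0. Qed.

Lemma normc_sum (R : realType) (M : nat) (F : 'I_M -> R[i]) :
  cmod (\sum_(j < M) F j) <= \sum_(j < M) cmod (F j).
Proof.
elim/big_ind2: _ => [|x1 x2 y1 y2 H1 H2|//].
  by rewrite ComplexField.Normc.normc0.
by apply: le_trans (le_normcD _ _) _; apply: lerD.
Qed.

(** The kernel is real and antisymmetric, so its Hermitian form is purely imaginary: the real parts
    of [E n * conj (E j)] cancel in pairs and the imaginary parts double. Division by [i pi] then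
    makes the form real. *)
Lemma discrete_form (R : realType) (M : nat) (E : 'I_M -> R[i]) :
  \sum_(j < M) (\sum_(n < M | n != j) E n / (j%:R - n%:R)%:C) * (E j)^*%C
  = 'i%C * (- (\sum_(j < M) \sum_(n < M | n != j)
      complex.Im (E j) * complex.Re (E n) / (j%:R - n%:R)) *+ 2)%:C.
Proof.
pose A (j n : 'I_M) :=
  complex.Re (E n) * complex.Re (E j) + complex.Im (E n) * complex.Im (E j).
pose B (j n : 'I_M) :=
  complex.Im (E n) * complex.Re (E j) - complex.Re (E n) * complex.Im (E j).
have H (j n : 'I_M) : E n / (j%:R - n%:R)%:C * (E j)^*%C
    = (A j n / (j%:R - n%:R))%:C + 'i%C * (B j n / (j%:R - n%:R))%:C.
  rewrite -fmorphV /= /A /B; case: (E n) (E j) => [p q] [r s].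
  by apply/eqP; rewrite eq_complex /=; apply/andP; split; apply/eqP; ring.
transitivity (\sum_(j < M) \sum_(n < M | n != j)
    ((A j n / (j%:R - n%:R))%:C + 'i%C * (B j n / (j%:R - n%:R))%:C)).
  apply: eq_bigr => j _; rewrite mulr_suml; apply: eq_bigr => n _.
  exact: H.
under eq_bigr => j _ do rewrite big_split /= -mulr_sumr -!rmorph_sum /=.
rewrite big_split /= -mulr_sumr -!rmorph_sum /=.
(* [A] is symmetric in its indices and the kernel is odd, so the sum equals its own negative. *)
have -> : \sum_(j < M) \sum_(n < M | n != j) A j n / (j%:R - n%:R) = 0.
  set x := LHS; have : x = - x.
    rewrite {1}/x sum_antisym; congr (- _).
    by do 2 (apply: eq_bigr => ? _); rewrite /A; congr (_ * _); congr (_ + _); rewrite mulrC.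
  by move/eqP; rewrite -addr_eq0 -mulr2n mulrn_eq0 /= => /eqP.
rewrite add0r; congr (_ * _%:C).
have -> : \sum_(j < M) \sum_(n < M | n != j) B j n / (j%:R - n%:R)
    = \sum_(j < M) \sum_(n < M | n != j) complex.Im (E n) * complex.Re (E j) / (j%:R - n%:R)
    - \sum_(j < M) \sum_(n < M | n != j) complex.Im (E j) * complex.Re (E n) / (j%:R - n%:R).
  rewrite -sumrB; apply: eq_bigr => j _; rewrite -sumrB; apply: eq_bigr => n _.
  by rewrite /B mulrBl (mulrC (complex.Re (E n))).
rewrite (@sum_antisym R M (fun j n => complex.Im (E n) * complex.Re (E j))).
by rewrite mulNrn mulr2n opprD.
Qed.

(** Pairing the equation with [E] gives (lambda - t) times the squared norm of [E], where t is the
    Rayleigh quotient of the singular part. Hilbert's inequality puts t in [-1, 1], where [d] bounds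
    the modulus from below. *)
Lemma discrete_stability (R : realType) (lambda : R[i]) (d : R) (M : nat)
    (E r : 'I_M -> R[i]) : 0 < d ->
  (forall t : R, -1 <= t <= 1 -> d <= cmod (lambda - t%:C)) ->
  (forall j, discrete_op lambda E j = r j) ->
  d ^+ 2 * \sum_(j < M) cmod (E j) ^+ 2 <= \sum_(j < M) cmod (r j) ^+ 2.
Proof.
move=> d0 hd Er.
set n2 := \sum_(j < M) cmod (E j) ^+ 2.
pose S := \sum_(j < M) \sum_(n < M | n != j)
      complex.Im (E j) * complex.Re (E n) / (j%:R - n%:R).
have n2E : n2 = \sum_(j < M) (complex.Re (E j) ^+ 2 + complex.Im (E j) ^+ 2).
  by apply: eq_bigr => j _; rewrite normc_sqr.
have Sle : `|S *+ 2| <= pi * n2 by rewrite n2E; exact: hilbert_inequality.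
have pi0 : 0 < pi :> R := pi_gt0 R.
have zE : \sum_(j < M) r j * (E j)^*%C = lambda * n2%:C + (S *+ 2 / pi)%:C.
  transitivity (\sum_(j < M) (lambda * (cmod (E j) ^+ 2)%:C - ('i%C * pi%:C)^-1
    * ((\sum_(n < M | n != j) E n / (j%:R - n%:R)%:C) * (E j)^*%C))).
    apply: eq_bigr => j _; rewrite -Er /discrete_op mulrBl -!mulrA; congr (_ * _ - _).
    rewrite normc_sqr; case: (E j) => x y.
    by apply/eqP; rewrite eq_complex /=; apply/andP; split; apply/eqP; ring.
  rewrite sumrB -!mulr_sumr -rmorph_sum discrete_form /= -/n2; congr (_ + _).
  rewrite mulrA -mulNr invfM mulrAC mulVf ?mul1r; last first.
    by rewrite eq_complex /= eqxx oner_eq0.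
  rewrite mulNr -fmorphV -rmorphM /= -rmorphN /=; congr _%:C.
  by rewrite mulrC mulNrn mulNr opprK.
have low : d * n2 <= cmod (lambda * n2%:C + (S *+ 2 / pi)%:C).
  have [n20|n20] := eqVneq n2 0; first by rewrite n20 mulr0 normc_ge0.
  have n2p : 0 < n2.
    by rewrite lt_def n20 sumr_ge0// => j _; rewrite sqr_ge0.
  (* The real number subtracted from [lambda] is the Rayleigh quotient. *)
  have -> : lambda * n2%:C + (S *+ 2 / pi)%:C
      = (lambda - (- (S *+ 2) / (pi * n2))%:C) * n2%:C.
    rewrite mulrBl -rmorphM /= -rmorphN /=; congr (_ + _%:C).
    by move: pi0; move: (pi) => P P0; field; rewrite n20 gt_eqF.
  rewrite ComplexField.Normc.normcM.
  have -> : cmod n2%:C = n2 by rewrite /= expr0n addr0 sqrtr_sqr gtr0_norm.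
  rewrite ler_wpM2r ?(ltW n2p)//; apply: hd.
  rewrite -ler_norml mulNr normrN normrM normfV.
  by rewrite (gtr0_norm (mulr_gt0 pi0 n2p)) ler_pdivrMr ?mulr_gt0// mul1r.
have up : cmod (lambda * n2%:C + (S *+ 2 / pi)%:C)
    <= \sum_(j < M) cmod (r j) * cmod (E j).
  rewrite -zE; apply: le_trans (normc_sum _ _ _) _; apply: ler_sum => j _.
  rewrite ComplexField.Normc.normcM.
  by case: (E j) => x y /=; rewrite sqrrN.
(* Summing [2 * d * |r| * |E| <= |r|^2 + d^2 * |E|^2] replaces the Cauchy-Schwarz inequality; one
   copy of [d ^+ 2 * n2] is then absorbed on the left. *)
have : d *+ 2 * (d * n2) <= \sum_(j < M) cmod (r j) ^+ 2 + d ^+ 2 * n2.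
  apply: le_trans (_ : d *+ 2 * \sum_(j < M) cmod (r j) * cmod (E j) <= _).
    by rewrite ler_wpM2l ?(le_trans low up)// mulrn_wge0// ltW.
  rewrite /n2 !mulr_sumr -big_split /=; apply: ler_sum => j _.
  rewrite -subr_ge0; apply: le_trans (sqr_ge0 (cmod (r j) - d * cmod (E j))) _.
  by rewrite le_eqVlt; apply/orP; left; apply/eqP; ring.
by lra.
Qed.

(** Stability with zero right-hand side makes the square matrix injective, hence invertible. *)
Lemma discrete_exists (R : realType) (lambda : R[i]) (d : R) (M : nat)
    (F : 'I_M -> R[i]) : 0 < d ->
  (forall t : R, -1 <= t <= 1 -> d <= cmod (lambda - t%:C)) ->
  exists! U : 'cV[R[i]]_M, forall j, discrete_op lambda (fun n => U n 0) j = F j.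
Proof.
move=> d0 hd.
pose A : 'M[R[i]]_M := \matrix_(j, n)
  (if n == j then lambda else - (('i%C * pi%:C)^-1 * (j%:R - n%:R)%:C^-1)).
have AE (U : 'cV[R[i]]_M) j : (A *m U) j 0 = discrete_op lambda (fun n => U n 0) j.
  rewrite !mxE (bigD1 j) //= !mxE eqxx /discrete_op; congr (_ + _).
  rewrite mulr_sumr -sumrN; apply: eq_bigr => n nj.
  by rewrite !mxE (negbTE nj) mulNr; congr (- _); rewrite -mulrA; congr (_ * _); rewrite mulrC.
have inj (U : 'cV[R[i]]_M) : A *m U = 0 -> U = 0.
  move=> AU0.
  have := @discrete_stability R lambda d M (fun n => U n 0) (fun=> 0) d0 hd.
  have H j : discrete_op lambda (fun n => U n 0) j = 0 by rewrite -AE AU0 mxE.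
  move=> /(_ H); rewrite [leRHS]big1 => [|j _]; last first.
    by rewrite ComplexField.Normc.normc0 expr0n.
  rewrite pmulr_rle0 ?exprn_gt0// => U0.
  apply/matrixP => j k; rewrite ord1 mxE.
  apply: ComplexField.Normc.eq0_normc; apply/eqP; rewrite -sqrf_eq0.
  have : \sum_(j < M) cmod (U j 0) ^+ 2 == 0.
    by rewrite eq_le U0 sumr_ge0// => i _; rewrite sqr_ge0.
  rewrite psumr_eq0 => [/allP/(_ j)|i _]; last by rewrite sqr_ge0.
  by rewrite mem_index_enum => /(_ isT).
have Aunit : A \in unitmx.
  rewrite unitmxE unitfE -det_tr; apply/det0P => -[v v0 vA].
  move/negP: v0; apply; apply/eqP/trmx_inj; rewrite trmx0; apply: inj.
  by apply: trmx_inj; rewrite trmx_mul trmxK trmx0.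
exists (invmx A *m \col_j F j); split => [j|U HU].
  by rewrite -AE mulKVmx// mxE.
rewrite -[RHS](mulKmx Aunit); congr (_ *m _).
by apply/matrixP => j k; rewrite ord1 AE HU mxE.
Qed.

(** The bound is explicit, without compactness: the modulus of the imaginary part of [lambda] if
    that is nonzero, and otherwise the excess of the modulus of the real part over 1. *)
Lemma resolvent_dist (R : realType) (lambda : R[i]) :
  (forall t : R, t \in `[-1, 1] -> lambda <> t%:C) ->
  exists2 d : R, 0 < d & forall t : R, -1 <= t <= 1 -> d <= cmod (lambda - t%:C).
Proof.
case: lambda => x y hl.
have E t : cmod ((x +i* y) - t%:C) = Num.sqrt ((x - t) ^+ 2 + y ^+ 2).
  by rewrite /= subr0.
have [y0|y0] := eqVneq y 0; last first.
  exists `|y|; first by rewrite normr_gt0.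
  move=> t _; rewrite E -sqrtr_sqr ler_wsqrtr// lerDr sqr_ge0//.
have x1 : 1 < `|x|.
  rewrite ltNge; apply/negP; rewrite ler_norml => /andP[x1 x2].
  by apply: (hl x); rewrite ?in_itv /= ?x1 ?x2 // y0.
exists (`|x| - 1); first by rewrite subr_gt0.
move=> t /andP[t1 t2]; rewrite E y0 expr0n addr0 sqrtr_sqr.
apply: le_trans (lerB_dist x t); rewrite lerB// ler_norml t1 t2//.
Qed.

Lemma discrete_solutionP (R : realType) (a : R) (lambda : R[i])
    (f : R -> R[i]) (N M : nat) (U : 'cV[R[i]]_M) : (0 < N)%N ->
  is_discrete_solution a lambda f N U <->
  (forall j, discrete_op lambda (fun n => U n 0) j = f (midpoint a N j)).
Proof.
move=> N0.
have E j : lambda * U j 0 - ('i%C * pi%:C * N%:R)^-1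
      * (\sum_(n < M | n != j) U n 0 / (midpoint a N j - midpoint a N n)%:C)
    = discrete_op lambda (fun n => U n 0) j.
  rewrite /discrete_op; congr (_ - _).
  rewrite invfM -mulrA; congr (_ * _); rewrite mulr_sumr.
  apply: eq_bigr => n nj.
  have N0' : N%:R != 0 :> R by rewrite pnatr_eq0 -lt0n.
  rewrite mulrCA; congr (_ * _).
  have -> : midpoint a N j - midpoint a N n = (j%:R - n%:R) / N%:R.
    by rewrite /midpoint /mesh_step -!natr1; field.
  have jn0 : j%:R - n%:R != 0 :> R by rewrite subr_eq0 eqr_nat eq_sym.
  rewrite -(rmorph_nat (real_complex R) N) -!fmorphV -rmorphM /=; congr _%:C.
  by field; rewrite N0' jn0.
by split=> H j; [rewrite -E|rewrite E].
Qed.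

(** * Integrals over single cells *)

(* Both sides are compared through their derivatives in the upper endpoint, so
   neither [eta] nor [g] needs to be continuous. *)
Lemma integral_approx (R : realType) (c d : R) (f eta g H G : R -> R) : c < d ->
  {in `[c, d], continuous f} ->
  (forall y, y \in `[c, d] -> is_derive y 1 H (eta y)) ->
  (forall y, y \in `[c, d] -> is_derive y 1 G (g y)) ->
  (forall y, y \in `[c, d] -> `|f y - eta y| <= g y) ->
  `|\int[lebesgue_measure]_(y in `[c, d]) f y - (H d - H c)| <= G d - G c.
Proof.
move=> cd cf dH dG fg.
have cfw : {within `[c, d], continuous f}.
  by apply: continuous_in_subspaceT => y; rewrite inE; exact: cf.
have fi : lebesgue_measure.-integrable `[c, d] (EFin \o f).
  by apply: continuous_compact_integrable => //; exact: segment_compact.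
pose F x := \int[lebesgue_measure]_(t in `[c, x]) f t.
have Fc : F c = 0 by rewrite /F set_itv1 Rintegral_set1.
have cF : {within `[c, d], continuous F}.
  exact: parameterized_integral_continuous (ltW cd) fi.
have sub y : y \in `]c, d[ -> y \in `[c, d].
  by rewrite !in_itv /= => /andP[/ltW-> /ltW->].
have dF y : y \in `]c, d[ -> is_derive y 1 F (f y).
  move=> ycd; have /andP[cy yd] : c < y < d by move: ycd; rewrite in_itv.
  have [dFy Fy] := @continuous_FTC1_closed _ f c y d yd fi cy (cf y (sub y ycd)).
  by apply: DeriveDef; [exact: dFy|rewrite -derive1E; exact: Fy].
have cH : {within `[c, d], continuous H}.
  by apply: derivable_within_continuous => y /dH [].
have cG : {within `[c, d], continuous G}.
  by apply: derivable_within_continuous => y /dG [].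
rewrite -/(F d) ler_norml; apply/andP; split.
  have dFHG y : y \in `]c, d[ -> is_derive y 1 (F - H + G) (f y - eta y + g y).
    move=> yI; have ? := dF y yI; have ? := dH y (sub y yI).
    by have ? := dG y (sub y yI); exact: is_deriveD.
  have cFHG : {within `[c, d], continuous (F - H + G)}.
    move=> y; apply: continuousD; last exact: cG.
    by apply: continuousD; [exact: cF|exact/continuousN/cH].
  have [y yI] := MVT cd dFHG cFHG.
  rewrite -[(F - H + G) d]/(F d - H d + G d) -[(F - H + G) c]/(F c - H c + G c).
  have : 0 <= (f y - eta y + g y) * (d - c).
    rewrite mulr_ge0 ?subr_ge0 ?(ltW cd)//.
    by have := fg y (sub y yI); rewrite ler_norml => /andP[? _]; lra.
  by rewrite Fc; lra.
have dFHG y : y \in `]c, d[ -> is_derive y 1 (G - (F - H)) (g y - (f y - eta y)).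
  move=> yI; have ? := dF y yI; have ? := dH y (sub y yI).
  by have ? := dG y (sub y yI); exact: is_deriveB.
have cFHG : {within `[c, d], continuous (G - (F - H))}.
  move=> y; apply: continuousD; first exact: cG.
  by apply/continuousN/continuousD; [exact: cF|exact/continuousN/cH].
have [y yI] := MVT cd dFHG cFHG.
rewrite -[(G - (F - H)) d]/(G d - (F d - H d)) -[(G - (F - H)) c]/(G c - (F c - H c)).
have : 0 <= (g y - (f y - eta y)) * (d - c).
  rewrite mulr_ge0 ?subr_ge0 ?(ltW cd)//.
  by have := fg y (sub y yI); rewrite ler_norml => /andP[_ ?]; lra.
by rewrite Fc; lra.
Qed.

Lemma Rintegral_cat (R : realType) (c d e : R) (f : R -> R) : c <= d -> d <= e ->
  {in `[c, e], continuous f} ->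
  \int[lebesgue_measure]_(y in `[c, e]) f y =
  \int[lebesgue_measure]_(y in `[c, d]) f y + \int[lebesgue_measure]_(y in `[d, e]) f y.
Proof.
move=> cd de cf.
have fi : lebesgue_measure.-integrable `[c, e] (EFin \o f).
  apply: continuous_compact_integrable; first exact: segment_compact.
  by apply: continuous_in_subspaceT => y; rewrite inE; exact: cf.
rewrite -(@Rintegral_itv_obnd_cbnd _ d); last first.
  by apply: integrableS fi => //; apply: subset_itvr; rewrite bnd_simp.
by rewrite -(@Rintegral_itvB _ f (BLeft c) (BRight e) d fi)// addrC subrK.
Qed.

Lemma Rintegral_chain (R : realType) (p s e : nat -> R) (f : R -> R) (m : nat) :
  {homo p : i j / (i <= j)%N >-> i <= j} ->
  {in `[p 0%N, p m], continuous f} ->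
  (forall i, (i < m)%N ->
    `|\int[lebesgue_measure]_(y in `[p i, p i.+1]) f y - s i| <= e i) ->
  `|\int[lebesgue_measure]_(y in `[p 0%N, p m]) f y - \sum_(i < m) s i|
  <= \sum_(i < m) e i.
Proof.
move=> pm; elim: m => [|m IH] cf H.
  by rewrite !big_ord0 set_itv1 Rintegral_set1 subr0 normr0.
rewrite !big_ord_recr /= (@Rintegral_cat _ _ (p m)) ?pm//.
rewrite opprD addrACA; apply: le_trans (ler_normD _ _) _; apply: lerD.
  apply: IH => [y|i im].
    rewrite in_itv /= => /andP[y1 y2]; apply: cf; rewrite in_itv /= y1.
    by rewrite (le_trans y2)// pm.
  by apply: H; rewrite ltnS ltnW.
exact: H.
Qed.

Lemma hoelder_continuous (R : realType) (alpha K : R) (w : R -> R) : 0 < alpha ->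
  (forall x y, `|w x - w y| <= K * `|x - y| `^ alpha) -> continuous w.
Proof.
move=> a0 hw x; apply/cvgrPdist_le => /= e e0.
(* Solves [(|K| + 1) * d ^ alpha = e]; the added 1 keeps the quotient meaningful when [K = 0]. *)
pose d := (e / (`|K| + 1)) `^ alpha^-1.
have K1 : 0 < `|K| + 1 by rewrite ltr_wpDl.
have d0 : 0 < d by rewrite powR_gt0// divr_gt0.
near=> y.
apply: le_trans (hw x y) _.
apply: le_trans (_ : `|K| * `|x - y| `^ alpha <= _).
  by rewrite ler_wpM2r ?powR_ge0 ?ler_norm.
apply: le_trans (_ : `|K| * (d `^ alpha) <= _).
  rewrite ler_wpM2l// ge0_ler_powR ?nnegrE ?(ltW a0) ?(ltW d0)//.
rewrite /d -powRrM mulVf ?gt_eqF// powRr1; last by rewrite divr_ge0 ?(ltW e0) ?(ltW K1).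
by rewrite mulrCA ger_pMr// ler_pdivrMr// mul1r lerDl.
Unshelve. all: by end_near. Qed.

(** With [s = 1] to the left of [x] and [s = -1] to the right, the argument of [ln] is positive. The
    factor cancels in the derivative, so both sides of the singularity are treated at once. *)
Lemma is_derive_ln_dist (R : realType) (s x y : R) : 0 < s * (x - y) ->
  is_derive y 1 (fun y => - ln (s * (x - y))) (x - y)^-1.
Proof.
move=> sxy.
have D1 : is_derive y 1 (fun y => s * (x - y)) (- s).
  rewrite (_ : (fun y => _) = s \*: (cst x - @id R)); last by [].
  by apply: is_derive_eq; rewrite /GRing.scale /= sub0r mulrN mulr1.
have D2 := is_derive1_ln sxy.
have D3 := @is_derive1_comp _ (@ln R) (fun y => s * (x - y)) y _ _ D2 D1.
rewrite (_ : (fun y => _) = - (@ln R \o (fun y => s * (x - y)))); last by [].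
have s0 : s != 0 by apply: contraTneq sxy => ->; rewrite mul0r ltxx.
have xy0 : x - y != 0 by apply: contraTneq sxy => ->; rewrite mulr0 ltxx.
apply: is_derive_eq.
by field; rewrite s0 xy0.
Qed.

Lemma kernel_continuous (R : realType) (w : R -> R) (x y : R) :
  continuous w -> x - y != 0 -> {for y, continuous (fun y => w y / (x - y))}.
Proof.
move=> cw xy.
apply: cvgM; first exact: cw.
apply: cvgV => //; apply: cvgB; [exact: cvg_cst|exact: cvg_id].
Qed.

(** Write [w y] as [w x] plus an increment. The part with [w x] is integrated exactly and produces
    the logarithms; in the increment, [y] is replaced by the midpoint [z] in numerator and
    denominator. The coefficient of [w x] is the quadrature error of the bare kernel, left
    unestimated here since it cancels only globally. *)
Lemma cell_estimate (R : realType) (alpha K : R) (w : R -> R) (s x c h : R) :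
  0 < alpha <= 1 ->
  (forall x y, `|w x - w y| <= K * `|x - y| `^ alpha) ->
  0 < h -> (forall y, y \in `[c, c + h] -> 0 < s * (x - y)) ->
  h <= `|x - (c + h / 2)| ->
  `|\int[lebesgue_measure]_(y in `[c, c + h]) (w y / (x - y))
    - (h * w (c + h / 2) / (x - (c + h / 2))
       + w x * (- ln (s * (x - (c + h))) + ln (s * (x - c)) - h / (x - (c + h / 2))))|
  <= 3 * K * h `^ alpha * (h / `|x - (c + h / 2)|).
Proof.
move=> /andP[a0 a1] hw h0 sxy hD.
set z := c + h / 2 in hD *; set D := `|x - z| in hD *.
have D0 : 0 < D by exact: lt_le_trans hD.
have K0 : 0 <= K.
  have := le_trans (normr_ge0 _) (hw 1 0).
  by rewrite subr0 normr1 powR1 mulr1.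
have xz : x - z != 0 by rewrite -normr_gt0.
have xyn y : y \in `[c, c + h] -> x - y != 0.
  by move=> /sxy; apply: contraTneq => ->; rewrite mulr0 ltxx.
have cw : continuous w by exact: hoelder_continuous hw.
pose L y := - ln (s * (x - y)).
pose H := ((w z - w x) / (x - z)) \*: @id R + w x \*: L.
pose c0 := 3 * K * h `^ alpha / D.
pose G := c0 \*: @id R.
have ch : c < c + h by rewrite ltrDl.
have := @integral_approx R c (c + h) (fun y => w y / (x - y))
  (fun y => (w z - w x) / (x - z) + w x * (x - y)^-1) (fun=> c0) H G ch.
have -> : H (c + h) - H c = h * w z / (x - z)
       + w x * (- ln (s * (x - (c + h))) + ln (s * (x - c)) - h / (x - z)).
  transitivity ((w z - w x) / (x - z) * (c + h) + w x * L (c + h)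
    - ((w z - w x) / (x - z) * c + w x * L c)); first by [].
  by rewrite /L; field.
have -> : G (c + h) - G c = 3 * K * h `^ alpha * (h / D).
  transitivity (c0 * (c + h) - c0 * c); first by [].
  by rewrite /c0; field; rewrite gt_eqF.
move=> IA; refine (IA _ _ _ _).
- by move=> y yI; apply: kernel_continuous => //; exact: xyn.
- move=> y yI; have ? := is_derive_ln_dist R s x y (sxy y yI).
  by apply: is_derive_eq; rewrite /GRing.scale /= mulr1.
- by move=> y yI; apply: is_derive_eq; rewrite /GRing.scale /= mulr1.
move=> y yI; have xy := xyn y yI.
(* The first term is the Hoelder increment within the cell, the second the cost of moving the kernel
   to the midpoint. As |x - y| >= D/2, they contribute 2 and 1 to the constant 3. *)
have -> : w y / (x - y) - ((w z - w x) / (x - z) + w x * (x - y)^-1)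
    = (w y - w z) / (x - y) + (w z - w x) * ((y - z) / ((x - y) * (x - z))).
  by field; rewrite xy xz.
have yz : `|y - z| <= h / 2.
  move: yI; rewrite in_itv /= /z => /andP[y1 y2].
  by rewrite ler_norml; apply/andP; split; lra.
have xyD : D / 2 <= `|x - y|.
  have := ler_normD (x - y) (y - z); rewrite addrA subrK -/D.
  by lra.
have xy0 : 0 < `|x - y| by rewrite normr_gt0.
have xyV : `|x - y|^-1 <= 2 / D.
  by rewrite -[2 / D]invrK invf_div lef_pV2 ?posrE// divr_gt0.
apply: le_trans (ler_normD _ _) _.
rewrite !(normrM, normfV) -/D invfM.
have t1 : `|w y - w z| * `|x - y|^-1 <= K * h `^ alpha * (2 / D).
  apply: ler_pM => //.
  apply: le_trans (hw y z) _; rewrite ler_wpM2l// ge0_ler_powR ?nnegrE ?(ltW a0) ?(ltW h0)//.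
  by apply: le_trans yz _; lra.
have t2 : `|w z - w x| * (`|y - z| * (`|x - y|^-1 * D^-1))
    <= K * D `^ alpha * (h / 2 * (2 / D * D^-1)).
  apply: ler_pM => //; first by rewrite mulr_ge0// mulr_ge0// invr_ge0// ltW.
    by rewrite /D distrC; exact: hw.
  apply: ler_pM => //; first by rewrite mulr_ge0// invr_ge0// ltW.
  by rewrite ler_wpM2r// invr_ge0 ltW.
(* Since [D / h >= 1] and [alpha <= 1], one has [(D / h) ^ alpha <= D / h]; this turns the growth
   [D ^ alpha] of the increment into [h ^ alpha]. *)
have Dh : D `^ alpha * h <= h `^ alpha * D.
  have hD0 : 0 <= D / h by rewrite divr_ge0// ltW.
  have hh0 : 0 <= h `^ alpha * h by rewrite mulr_ge0 ?powR_ge0// ltW.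
  have -> : h `^ alpha * D = D / h * (h `^ alpha * h).
    by field; rewrite gt_eqF.
  rewrite -[X in X `^ _ * _](@divfK _ h) ?gt_eqF// powRM ?(ltW h0)// -mulrA.
  by rewrite ler_wpM2r// ler1_powR// ler_pdivlMr// mul1r.
apply: le_trans (lerD t1 t2) _.
have -> : K * D `^ alpha * (h / 2 * (2 / D * D^-1)) = K / D / D * (D `^ alpha * h).
  by field; rewrite gt_eqF.
have KDD : 0 <= K / D / D by rewrite !divr_ge0// ltW.
apply: le_trans (lerD (lexx _) (ler_wpM2l KDD Dh)) _.
rewrite /c0 le_eqVlt; apply/orP; left; apply/eqP.
by field; rewrite gt_eqF.
Qed.

(** Next to [x] the Hoelder condition bounds the increment part by [K |x - y| ^ (alpha - 1)], an
    integrable singularity. Its primitive gives [r ^ alpha / alpha] however close the interval comes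
    to [x], so the bound is uniform in the cutoff. *)
Lemma half_cell_estimate (R : realType) (alpha K : R) (w : R -> R) (s x c d r : R) :
  0 < alpha ->
  (forall x y, `|w x - w y| <= K * `|x - y| `^ alpha) ->
  s = 1 \/ s = -1 -> c < d -> (forall y, y \in `[c, d] -> 0 < s * (x - y) <= r) ->
  `|\int[lebesgue_measure]_(y in `[c, d]) (w y / (x - y))
    - w x * (- ln (s * (x - d)) + ln (s * (x - c)))|
  <= K * r `^ alpha / alpha.
Proof.
move=> a0 hw hs cd sxy.
have K0 : 0 <= K.
  have := le_trans (normr_ge0 _) (hw 1 0).
  by rewrite subr0 normr1 powR1 mulr1.
have ss : s * s = 1 by case: hs => ->; rewrite ?mulr1 ?mulrNN ?mulr1.
have ns : `|s| = 1 by case: hs => ->; rewrite ?normrN normr1.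
have sxy0 y : y \in `[c, d] -> 0 < s * (x - y) by move=> /sxy /andP[].
have xyn y : y \in `[c, d] -> x - y != 0.
  by move=> /sxy0; apply: contraTneq => ->; rewrite mulr0 ltxx.
have cw : continuous w by exact: hoelder_continuous hw.
pose L y := - ln (s * (x - y)).
pose H := w x \*: L.
pose G := (- (s * (K / alpha))) \*: ((@powR R ^~ alpha) \o (fun y => s * (x - y))).
have := @integral_approx R c d (fun y => w y / (x - y))
  (fun y => w x * (x - y)^-1) (fun y => K * (s * (x - y)) `^ (alpha - 1)) H G cd.
have -> : H d - H c = w x * (- ln (s * (x - d)) + ln (s * (x - c))).
  transitivity (w x * L d - w x * L c); first by [].
  by rewrite /L; ring.
have GE : G d - G c = (- (s * (K / alpha))) * (s * (x - d)) `^ alpha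
    - (- (s * (K / alpha))) * (s * (x - c)) `^ alpha by [].
have GB : G d - G c <= K * r `^ alpha / alpha.
  have Ka : 0 <= K / alpha by rewrite divr_ge0// ltW.
  have B y : y \in `[c, d] ->
      0 <= K / alpha * (s * (x - y)) `^ alpha <= K / alpha * r `^ alpha.
    move=> yI; have /andP[l1 l2] := sxy y yI.
    rewrite mulr_ge0 ?powR_ge0//= ler_wpM2l// ge0_ler_powR ?nnegrE ?(ltW a0) ?(ltW l1)//.
    by rewrite (le_trans (ltW l1)).
  have cI : c \in `[c, d] by rewrite bound_itvE ltW.
  have dI : d \in `[c, d] by rewrite bound_itvE ltW.
  have /andP[Bc1 Bc2] := B c cI; have /andP[Bd1 Bd2] := B d dI.
  by rewrite GE mulrAC; case: hs Bc1 Bc2 Bd1 Bd2 => ->; lra.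
move=> IA; apply: le_trans GB; apply: IA.
- by move=> y yI; apply: kernel_continuous => //; exact: xyn.
- move=> y yI; have ? := is_derive_ln_dist R s x y (sxy0 y yI).
  by apply: is_derive_eq.
- move=> y yI.
  have D1 : is_derive y 1 (fun y => s * (x - y)) (- s).
    rewrite (_ : (fun y => _) = s \*: (cst x - @id R)); last by [].
    by apply: is_derive_eq; rewrite /GRing.scale /= sub0r mulrN mulr1.
  have D2 := is_derive1_powR alpha (sxy0 y yI).
  have D3 := @is_derive1_comp _ _ _ y _ _ D2 D1.
  apply: is_derive_eq; rewrite /GRing.scale /=.
  set q := _ `^ _.
  transitivity (s * s * (K * q)); last by rewrite ss mul1r.
  by field; rewrite gt_eqF.
move=> y yI; have xy := xyn y yI.
rewrite -mulrBl normrM normfV.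
have -> : `|x - y| = s * (x - y).
  by rewrite -[RHS]gtr0_norm ?sxy0// normrM ns mul1r.
have q0 := sxy0 y yI.
rewrite ler_pdivrMr//; apply: le_trans (hw y x) _.
have -> : `|y - x| = s * (x - y).
  by rewrite distrC -[RHS]gtr0_norm ?sxy0// normrM ns mul1r.
rewrite -(mulr_powRB1 (ltW q0) a0) -[leRHS]mulrA ler_wpM2l// mulrC lexx//.
Qed.

(** * Harmonic sums and truncated integrals *)

Definition harmonic_sum {R : realType} (m : nat) : R := \sum_(i < m) i.+1%:R^-1.

Lemma harmonic_sum_ge0 (R : realType) (m : nat) : 0 <= harmonic_sum m :> R.
Proof. by rewrite sumr_ge0. Qed.

Lemma harmonic_sum_rev (R : realType) (j : nat) :
  \sum_(i < j) (j%:R - i%:R)^-1 = harmonic_sum j :> R.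
Proof.
rewrite /harmonic_sum (reindex_inj rev_ord_inj) /=; apply: eq_bigr => i _.
by rewrite natrB// opprB addrC subrK.
Qed.

Lemma harmonic_sum_le (R : realType) (m M : nat) : (m <= M)%N -> (0 < M)%N ->
  harmonic_sum m <= 1 + ln M%:R :> R.
Proof.
move=> mM M0; apply: le_trans (_ : harmonic_sum M <= _).
  rewrite /harmonic_sum -(subnKC mM) big_split_ord /= lerDl sumr_ge0// => i _.
case: M M0 {mM} => // M _; elim: M => [|M IH].
  by rewrite /harmonic_sum big_ord1 ln1 addr0 invr1.
rewrite /harmonic_sum big_ord_recr /=; apply: le_trans (lerD IH (lexx _)) _.
rewrite -addrA lerD2l.
have M1 : 0 < M.+1%:R :> R by rewrite ltr0n.
have M2 : 0 < M.+2%:R :> R by rewrite ltr0n.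
have q0 : 0 < M.+1%:R / M.+2%:R :> R by rewrite divr_gt0.
have := @le_ln1Dx R (M.+1%:R / M.+2%:R - 1).
rewrite addrCA subrr addr0 ln_div ?posrE// => H.
have {}H : ln M.+1%:R - ln M.+2%:R <= M.+1%:R / M.+2%:R - 1 :> R.
  by apply: H; rewrite ltrBrDr addNr.
have E : M.+1%:R / M.+2%:R = 1 - M.+2%:R^-1 :> R.
  have n2 : M.+2%:R != 0 :> R by rewrite gt_eqF.
  by apply: (mulIf n2); rewrite mulrBl mul1r mulVf// divfK// -(natr1 M.+1) addrK.
by move: H; rewrite E; move: (ln _) (ln _) (_^-1) => ? ? ?; lra.
Qed.

(** Exact integral of the kernel over one side of [x], stripped of the logarithms of cutoff and
    step, minus its midpoint sum over [m] cells. It tends to minus Euler's constant. *)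
Definition euler_gap {R : realType} (m : nat) : R :=
  ln (m%:R + 2^-1) - harmonic_sum m.

(** The logarithmic increment lies between [1/(m + 3/2)] and [1/(m + 1/2)], and so does [1/(m + 1)].
    The right-hand side is chosen to telescope; its factor 2 makes [e1] an equality at [m = 0]. *)
Lemma euler_gap_step (R : realType) (m : nat) :
  `|euler_gap m.+1 - euler_gap m| <= 2 * (m.+1%:R^-1 - m.+2%:R^-1) :> R.
Proof.
rewrite /euler_gap /harmonic_sum big_ord_recr /= -!(natr1 m.+1) -!(natr1 m).
set t : R := m%:R; have t0 : 0 <= t by rewrite /t ler0n.
set S := \sum_(_ < _) _.
have p1 : 0 < t + 2^-1 by lra.
have p2 : 0 < t + 1 + 2^-1 by lra.
have r1 : ln (t + 1 + 2^-1) - ln (t + 2^-1) <= (t + 2^-1)^-1.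
  rewrite -ln_div ?posrE//.
  have -> : (t + 1 + 2^-1) / (t + 2^-1) = 1 + (t + 2^-1)^-1.
    by field; lra.
  by apply: le_ln1Dx; rewrite (@lt_trans _ _ 0)// ?invr_gt0//; lra.
have r2 : ln (t + 2^-1) - ln (t + 1 + 2^-1) <= - (t + 1 + 2^-1)^-1.
  rewrite -ln_div ?posrE//.
  have -> : (t + 2^-1) / (t + 1 + 2^-1) = 1 + - (t + 1 + 2^-1)^-1.
    by field; lra.
  apply: le_ln1Dx; rewrite ltrN2 invf_lt1//; lra.
have e1 : (t + 2^-1)^-1 - (t + 1)^-1 <= 2 * ((t + 1)^-1 - (t + 1 + 1)^-1).
  rewrite -subr_ge0.
  have -> : 2 * ((t + 1)^-1 - (t + 1 + 1)^-1) - ((t + 2^-1)^-1 - (t + 1)^-1)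
     = (3 / 2 * t) / ((t + 2^-1) * (t + 1) * (t + 1 + 1)).
    by field; rewrite !gt_eqF//; lra.
  by rewrite divr_ge0// ?mulr_ge0//; lra.
have e2 : (t + 1)^-1 - (t + 1 + 2^-1)^-1 <= 2 * ((t + 1)^-1 - (t + 1 + 1)^-1).
  rewrite -subr_ge0.
  have -> : 2 * ((t + 1)^-1 - (t + 1 + 1)^-1) - ((t + 1)^-1 - (t + 1 + 2^-1)^-1)
     = (3 / 2 * t + 2) / ((t + 1 + 2^-1) * (t + 1) * (t + 1 + 1)).
    by field; rewrite !gt_eqF//; lra.
  by rewrite divr_ge0// ?mulr_ge0//; lra.
move: r1 r2 e1 e2; move: (ln (t + 2^-1)) (ln (t + 1 + 2^-1)) => u v.
move: (t + 2^-1)^-1 (t + 1)^-1 (t + 1 + 1)^-1 (t + 1 + 2^-1)^-1 => p q r z *.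
by rewrite ler_norml; apply/andP; split; lra.
Qed.

(** Telescoping the steps from the smaller index compares the two gaps directly, without their
    common limit. The rate 1/m is enough because only square summability matters later. *)
Lemma euler_gap_dist (R : realType) (m k : nat) :
  `|euler_gap m - euler_gap k| <= 2 * (m.+1%:R^-1 + k.+1%:R^-1) :> R.
Proof.
have H (i d : nat) : `|euler_gap (i + d) - euler_gap i|
    <= 2 * (i.+1%:R^-1 - (i + d).+1%:R^-1) :> R.
  elim: d => [|d IH]; first by rewrite addn0 !subrr normr0 mulr0.
  rewrite addnS -(subrK (euler_gap (i + d)) (euler_gap _)) -addrA.
  apply: le_trans (ler_normD _ _) _.
  have := euler_gap_step R (i + d); move: IH.
  by move: `|_| `|_| _^-1 _^-1 _^-1 => ? ? p q r; lra.
have V (i : nat) : 0 <= i.+1%:R^-1 :> R by rewrite invr_ge0.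
wlog mk : m k / (m <= k)%N.
  move=> W; have [mk|/ltnW km] := leqP m k; first exact: W.
  by rewrite distrC (addrC _^-1); exact: W.
rewrite distrC -(subnKC mk); apply: le_trans (H _ _) _.
by have := V m; have := V (m + (k - m))%N; move: _^-1 _^-1 => p q; lra.
Qed.

Lemma sum_inv_sqr_le2 (R : realType) (M : nat) :
  \sum_(j < M) (j.+1%:R^-1) ^+ 2 <= 2 :> R.
Proof.
have [->|M0] := posnP M; first by rewrite big_ord0.
(* The bound 2 alone does not pass through the induction; [2 - 1/M] does. *)
apply: le_trans (_ : 2 - M%:R^-1 <= _); last by rewrite gerBl invr_ge0.
case: M M0 => // M _; elim: M => [|M IH].
  by rewrite big_ord1 invr1 expr1n; lra.
rewrite big_ord_recr /=; apply: le_trans (lerD IH (lexx _)) _.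
rewrite -!(natr1 M.+1) -!(natr1 M).
set t : R := M%:R; have t0 : 0 <= t by rewrite /t ler0n.
rewrite -subr_ge0.
have -> : 2 - (t + 1 + 1)^-1 - (2 - (t + 1)^-1 + (t + 1 + 1)^-1 ^+ 2)
    = ((t + 1) * (t + 1 + 1) ^+ 2)^-1.
  by field; rewrite !gt_eqF//; lra.
by rewrite invr_ge0 mulr_ge0 ?sqr_ge0//; lra.
Qed.

Lemma big_ord_neq (R : realType) (j k : nat) (F : nat -> R) (o : 'I_(j + k.+1)) :
  o = j :> nat ->
  \sum_(n < j + k.+1 | n != o) F n =
  \sum_(i < j) F i + \sum_(i < k) F (j + i.+1)%N.
Proof.
move=> oj; rewrite big_mkcond big_split_ord /= big_ord_recl /=; congr (_ + _).
  apply: eq_bigr => i _; rewrite ifT//; apply/eqP => /(congr1 val) /= io.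
  by have := ltn_ord i; rewrite io oj ltnn.
rewrite ifF ?add0r; last by apply/negbF/eqP/val_inj; rewrite /= addn0 oj.
apply: eq_bigr => i _; rewrite ifT//; apply/eqP => /(congr1 val) /= io.
by move: io; rewrite oj /bump /= add1n -[RHS]addn0 => /addnI.
Qed.

(** Summed over consecutive cells, the logarithms telescope to the two ends of the block. *)
Lemma far_estimate (R : realType) (alpha K : R) (w : R -> R) (s x c h : R) (m : nat) :
  0 < alpha <= 1 ->
  (forall x y, `|w x - w y| <= K * `|x - y| `^ alpha) ->
  0 < h -> (forall y, y \in `[c, c + m%:R * h] -> 0 < s * (x - y)) ->
  (forall i, (i < m)%N -> h <= `|x - (c + i%:R * h + h / 2)|) ->
  `|\int[lebesgue_measure]_(y in `[c, c + m%:R * h]) (w y / (x - y))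
    - (\sum_(i < m) h * w (c + i%:R * h + h / 2) / (x - (c + i%:R * h + h / 2))
       + w x * (- ln (s * (x - (c + m%:R * h))) + ln (s * (x - c))
                - \sum_(i < m) h / (x - (c + i%:R * h + h / 2))))|
  <= 3 * K * h `^ alpha * \sum_(i < m) (h / `|x - (c + i%:R * h + h / 2)|).
Proof.
move=> a01 hw h0 sxy hD; have /andP[a0 a1] := a01.
pose p (i : nat) := c + i%:R * h.
have pS i : p i.+1 = p i + h by rewrite /p -natr1 mulrDl mul1r addrA.
have p0 : p 0%N = c by rewrite /p mul0r addr0.
have pmono : {homo p : i j / (i <= j)%N >-> i <= j}.
  by move=> i j ij; rewrite /p lerD2l ler_wpM2r ?(ltW h0)// ler_nat.
have cw : continuous w by exact: hoelder_continuous hw.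
have cf : {in `[p 0%N, p m], continuous (fun y => w y / (x - y))}.
  move=> y; rewrite p0 => /sxy yI; apply: kernel_continuous => //.
  by apply: contraTneq yI => ->; rewrite mulr0 ltxx.
have := @Rintegral_chain R p (fun i => h * w (p i + h / 2) / (x - (p i + h / 2))
  + w x * (- ln (s * (x - (p i.+1))) + ln (s * (x - p i)) - h / (x - (p i + h / 2))))
  (fun i => 3 * K * h `^ alpha * (h / `|x - (p i + h / 2)|)) _ m pmono cf.
rewrite -mulr_sumr big_split /= -mulr_sumr sumrB.
have -> : \sum_(i < m) (- ln (s * (x - p i.+1)) + ln (s * (x - p i)))
    = - ln (s * (x - p m)) + ln (s * (x - p 0%N)).
  elim: m {sxy hD cf} => [|m IH]; first by rewrite big_ord0 addNr.
  by rewrite big_ord_recr /= IH; ring.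
rewrite p0; apply => i im; rewrite pS; apply: cell_estimate => //; last exact: hD.
move=> y; rewrite in_itv /= -pS => /andP[y1 y2]; apply: sxy; rewrite in_itv /=.
have ci : c <= p i by rewrite -p0; exact: pmono.
by rewrite (le_trans ci y1) (le_trans y2)//; exact: pmono.
Qed.

(** The far cells end at distance [h / 2] from [x], where the half cell takes over, so [ln (h / 2)]
    cancels. The remaining [- ln e] meets its opposite in the mirror estimate on the right of
    [x]. *)
Lemma left_estimate (R : realType) (alpha K : R) (w : R -> R) (a h e x : R) (j : nat) :
  0 < alpha <= 1 ->
  (forall x y, `|w x - w y| <= K * `|x - y| `^ alpha) ->
  0 < h -> 0 < e < h / 2 ->
  x = a + j%:R * h + h / 2 ->
  `|\int[lebesgue_measure]_(y in `[a, x - e]) (w y / (x - y))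
    - (\sum_(i < j) w (a + i%:R * h + h / 2) / (j%:R - i%:R)
       + w x * (ln (x - a) - ln e - harmonic_sum j))|
  <= 3 * K * h `^ alpha * harmonic_sum j + K * (h / 2) `^ alpha / alpha.
Proof.
move=> a01 hw h0 /andP[e0 eh] xE; have /andP[a0 a1] := a01.
have cw : continuous w by exact: hoelder_continuous hw.
have jh : 0 <= j%:R * h by rewrite mulr_ge0// ltW.
have xz (i : 'I_j) : x - (a + i%:R * h + h / 2) = (j%:R - i%:R) * h.
  by rewrite xE; ring.
have ij0 (i : 'I_j) : 1 <= j%:R - i%:R :> R.
  by rewrite lerBrDl natr1 ler_nat ltn_ord.
have ij (i : 'I_j) : j%:R - i%:R != 0 :> R.
  by rewrite gt_eqF// (lt_le_trans _ (ij0 i)).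
have := @far_estimate R alpha K w 1 x a h j a01 hw h0.
have -> : \sum_(i < j) h * w (a + i%:R * h + h / 2) / (x - (a + i%:R * h + h / 2))
    = \sum_(i < j) w (a + i%:R * h + h / 2) / (j%:R - i%:R).
  by apply: eq_bigr => i _; rewrite xz; field; rewrite ij gt_eqF.
have -> : \sum_(i < j) h / (x - (a + i%:R * h + h / 2)) = harmonic_sum j.
  rewrite -harmonic_sum_rev; apply: eq_bigr => i _.
  by rewrite xz; field; rewrite ij gt_eqF.
have -> : \sum_(i < j) (h / `|x - (a + i%:R * h + h / 2)|) = harmonic_sum j.
  rewrite -harmonic_sum_rev; apply: eq_bigr => i _; rewrite xz gtr0_norm.
    by field; rewrite ij gt_eqF.
  by rewrite mulr_gt0// (lt_le_trans _ (ij0 i)).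
have y0 y : y \in `[a, x - e] -> 0 < x - y.
  by rewrite in_itv /= => /andP[_ ?]; lra.
have s1 y : y \in `[a, a + j%:R * h] -> 0 < 1 * (x - y).
  by rewrite mul1r in_itv /= => /andP[_ ?]; rewrite xE; lra.
have hD i : (i < j)%N -> h <= `|x - (a + i%:R * h + h / 2)|.
  move=> i_j; rewrite (xz (Ordinal i_j)) ger0_norm.
    by rewrite ler_peMl ?(ltW h0)// ij0.
  by rewrite mulr_ge0 ?(ltW h0)// (le_trans _ (ij0 (Ordinal i_j))).
move=> /(_ s1 hD) F.
have cd : a + j%:R * h < x - e by rewrite xE; lra.
have hI y : y \in `[a + j%:R * h, x - e] -> 0 < 1 * (x - y) <= h / 2.
  by rewrite mul1r in_itv /= xE => /andP[? ?]; apply/andP; split; lra.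
have half := half_cell_estimate R alpha K w 1 x _ _ _ a0 hw (or_introl erefl) cd hI.
rewrite (@Rintegral_cat _ _ (a + j%:R * h)); last 3 first.
- by rewrite lerDl.
- by rewrite xE; lra.
- by move=> y /y0 yI; apply: kernel_continuous => //; rewrite gt_eqF.
apply: le_trans (lerD F half); apply: le_trans (ler_normD _ _).
rewrite !mul1r opprB (addrCA x) subrr addr0 le_eqVlt; apply/orP; left; apply/eqP; congr `|_|.
have -> : x - (a + j%:R * h) = h / 2 by rewrite xE; ring.
by ring.
Qed.

Lemma right_estimate (R : realType) (alpha K : R) (w : R -> R) (x h e b : R) (k : nat) :
  0 < alpha <= 1 ->
  (forall x y, `|w x - w y| <= K * `|x - y| `^ alpha) ->
  0 < h -> 0 < e < h / 2 ->
  b = x + h / 2 + k%:R * h ->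
  `|\int[lebesgue_measure]_(y in `[x + e, b]) (w y / (x - y))
    - (- \sum_(i < k) w (x + i.+1%:R * h) / i.+1%:R
       + w x * (ln e - ln (b - x) + harmonic_sum k))|
  <= 3 * K * h `^ alpha * harmonic_sum k + K * (h / 2) `^ alpha / alpha.
Proof.
move=> a01 hw h0 /andP[e0 eh] bE; have /andP[a0 a1] := a01.
have cw : continuous w by exact: hoelder_continuous hw.
have kh : 0 <= k%:R * h by rewrite mulr_ge0// ltW.
have zE (i : 'I_k) : x + h / 2 + i%:R * h + h / 2 = x + i.+1%:R * h.
  by rewrite -natr1; field.
have xz (i : 'I_k) : x - (x + h / 2 + i%:R * h + h / 2) = - (i.+1%:R * h).
  by rewrite zE; ring.
have i0 (i : 'I_k) : i.+1%:R != 0 :> R by rewrite pnatr_eq0.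
have := @far_estimate R alpha K w (-1) x (x + h / 2) h k a01 hw h0.
have -> : \sum_(i < k) h * w (x + h / 2 + i%:R * h + h / 2)
      / (x - (x + h / 2 + i%:R * h + h / 2))
    = - \sum_(i < k) w (x + i.+1%:R * h) / i.+1%:R.
  rewrite -sumrN; apply: eq_bigr => i _; rewrite xz zE.
  by move: (w _) (i0 i) => v; move: (_.+1%:R) => t t0; field; rewrite t0 gt_eqF.
have -> : \sum_(i < k) h / (x - (x + h / 2 + i%:R * h + h / 2)) = - harmonic_sum k.
  rewrite -sumrN; apply: eq_bigr => i _.
  by rewrite xz; move: (i0 i); move: (_.+1%:R) => t t0; field; rewrite t0 gt_eqF.
have -> : \sum_(i < k) (h / `|x - (x + h / 2 + i%:R * h + h / 2)|) = harmonic_sum k.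
  apply: eq_bigr => i _; rewrite xz normrN gtr0_norm.
    by move: (i0 i); move: (_.+1%:R) => t t0; field; rewrite t0 gt_eqF.
  by rewrite mulr_gt0// ltr0n.
have y0 y : y \in `[x + e, b] -> x - y < 0.
  by rewrite in_itv /= => /andP[? _]; lra.
have s1 y : y \in `[x + h / 2, x + h / 2 + k%:R * h] -> 0 < -1 * (x - y).
  by rewrite in_itv /= => /andP[? _]; lra.
have hD i : (i < k)%N -> h <= `|x - (x + h / 2 + i%:R * h + h / 2)|.
  move=> i_k; rewrite (xz (Ordinal i_k)) normrN ger0_norm.
    by rewrite ler_peMl ?(ltW h0)// ler1n.
  by rewrite mulr_ge0 ?(ltW h0).
move=> /(_ s1 hD) F.
have cd : x + e < x + h / 2 by lra.
have hI y : y \in `[x + e, x + h / 2] -> 0 < -1 * (x - y) <= h / 2.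
  by rewrite in_itv /= => /andP[? ?]; apply/andP; split; lra.
have half := half_cell_estimate R alpha K w (-1) x _ _ _ a0 hw (or_intror erefl) cd hI.
rewrite (@Rintegral_cat _ _ (x + h / 2)); last 3 first.
- by lra.
- by rewrite bE; lra.
- by move=> y /y0 yI; apply: kernel_continuous => //; rewrite lt_eqF.
rewrite addrC; apply: le_trans (lerD F half); apply: le_trans (ler_normD _ _).
rewrite -bE le_eqVlt; apply/orP; left; apply/eqP; congr `|_|.
have -> : -1 * (x - b) = b - x by ring.
have -> : -1 * (x - (x + h / 2)) = h / 2 by ring.
have -> : -1 * (x - (x + e)) = e by ring.
by ring.
Qed.

Lemma integrable_setU d (T : measurableType d) (R : realType)
    (mu : {measure set T -> \bar R}) (A B : set T) (f : T -> \bar R) :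
  measurable A -> measurable B -> [disjoint A & B] ->
  mu.-integrable A f -> mu.-integrable B f -> mu.-integrable (A `|` B) f.
Proof.
move=> mA mB AB /integrableP[mfA iA] /integrableP[mfB iB].
have mf := (measurable_funU _ mA mB).2 (conj mfA mfB).
apply/integrableP; split => //; rewrite ge0_integral_setU//.
  by rewrite lte_add_pinfty.
exact: measurableT_comp.
Qed.

Lemma truncated_domain (R : realType) (a b x e : R) : a < x -> x < b -> 0 < e ->
  [set y | `]a, b[%classic y /\ e < `|y - x|] = `]a, x - e[ `|` `]x + e, b[.
Proof.
move=> ax xb e0; apply/seteqP; split => y /=; rewrite !in_itv /=.
  move=> [/andP[ay yb]]; rewrite lter_normr => /orP[h|h]; [right|left].
    by rewrite yb andbT; lra.
  by rewrite ay /=; lra.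
move=> [|] /andP[h1 h2].
  by split; [apply/andP; split; lra|rewrite lter_normr; apply/orP; right; lra].
by split; [apply/andP; split; lra|rewrite lter_normr; apply/orP; left; lra].
Qed.

Lemma truncated_integral (R : realType) (w : R -> R) (a b x e : R) :
  continuous w -> a < x - e -> x + e < b -> 0 < e ->
  \int[lebesgue_measure]_(y in [set y | `]a, b[%classic y /\ e < `|y - x|])
    (w y / (x - y))
  = \int[lebesgue_measure]_(y in `[a, x - e]) (w y / (x - y))
    + \int[lebesgue_measure]_(y in `[x + e, b]) (w y / (x - y)).
Proof.
move=> cw ax xb e0.
set f := fun y => w y / (x - y).
have iA : lebesgue_measure.-integrable `[a, x - e] (EFin \o f).
  apply: continuous_compact_integrable; first exact: segment_compact.
  apply: continuous_in_subspaceT => y; rewrite inE /= in_itv /= => /andP[_ ?].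
  by apply: kernel_continuous => //; rewrite gt_eqF//; lra.
have iB : lebesgue_measure.-integrable `[x + e, b] (EFin \o f).
  apply: continuous_compact_integrable; first exact: segment_compact.
  apply: continuous_in_subspaceT => y; rewrite inE /= in_itv /= => /andP[? _].
  by apply: kernel_continuous => //; rewrite lt_eqF//; lra.
have AB : [disjoint `]a, x - e[%classic & `]x + e, b[%classic].
  by apply/disj_setPS => y /= []; rewrite !in_itv /= => /andP[? ?] /andP[? ?]; lra.
have iA1 : lebesgue_measure.-integrable `]a, x - e] (EFin \o f).
  by apply: integrableS iA => //; apply: subset_itvr; rewrite bnd_simp.
have iB1 : lebesgue_measure.-integrable `]x + e, b] (EFin \o f).
  by apply: integrableS iB => //; apply: subset_itvr; rewrite bnd_simp.
have iA' : lebesgue_measure.-integrable `]a, x - e[ (EFin \o f).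
  by apply: integrableS iA1 => //; apply: subset_itvl; rewrite bnd_simp.
have iB' : lebesgue_measure.-integrable `]x + e, b[ (EFin \o f).
  by apply: integrableS iB1 => //; apply: subset_itvl; rewrite bnd_simp.
rewrite truncated_domain//; [|lra|lra].
rewrite Rintegral_setU//; last exact: integrable_setU.
by rewrite !Rintegral_itv_bndo_bndc// !Rintegral_itv_obnd_cbnd.
Qed.

(* The three summands bound the far cells, the cell containing x, and the
   quadrature error of the kernel 1/(x - y). *)
Definition pv_error {R : realType} (alpha K W h : R) (j k : nat) : R :=
  3 * K * h `^ alpha * (harmonic_sum j + harmonic_sum k)
  + 2 * K * (h / 2) `^ alpha / alpha
  + W * (2 * (j.+1%:R^-1 + k.+1%:R^-1)).

(** Adding the two sides cancels [ln e] and [ln h] and leaves [w x] times a difference of two Euler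
    gaps. The bound is free of [e] and thus survives the passage to the principal value. *)
Lemma truncated_pv_estimate (R : realType) (alpha K W : R) (w : R -> R)
    (a b h x e : R) (j k : nat) :
  0 < alpha <= 1 ->
  (forall x y, `|w x - w y| <= K * `|x - y| `^ alpha) -> `|w x| <= W ->
  0 < h -> 0 < e < h / 2 ->
  x = a + j%:R * h + h / 2 -> b = x + h / 2 + k%:R * h ->
  `|\int[lebesgue_measure]_(y in [set y | `]a, b[%classic y /\ e < `|y - x|])
      (w y / (x - y))
    - (\sum_(i < j) w (a + i%:R * h + h / 2) / (j%:R - i%:R)
       - \sum_(i < k) w (x + i.+1%:R * h) / i.+1%:R)|
  <= pv_error alpha K W h j k.
Proof.
move=> a01 hw wx h0 eh xE bE; have /andP[a0 a1] := a01; have /andP[e0 eh2] := eh.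
have cw : continuous w by exact: hoelder_continuous hw.
have jh : 0 <= j%:R * h by rewrite mulr_ge0// ltW.
have kh : 0 <= k%:R * h by rewrite mulr_ge0// ltW.
rewrite truncated_integral//; [|by rewrite xE; lra|by rewrite bE; lra].
have L := left_estimate R alpha K w a h e x j a01 hw h0 eh xE.
have U := right_estimate R alpha K w x h e b k a01 hw h0 eh bE.
have lj : ln (x - a) = ln (j%:R + 2^-1) + ln h.
  by rewrite -lnM ?posrE ?ltr_wpDl//; congr ln; rewrite xE; field.
have lk : ln (b - x) = ln (k%:R + 2^-1) + ln h.
  by rewrite -lnM ?posrE ?ltr_wpDl//; congr ln; rewrite bE; field.
have G : `|w x * (ln (x - a) - ln e - harmonic_sum j)
    + w x * (ln e - ln (b - x) + harmonic_sum k)|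
    <= W * (2 * (j.+1%:R^-1 + k.+1%:R^-1)).
  rewrite lj lk.
  have -> : w x * (ln (j%:R + 2^-1) + ln h - ln e - harmonic_sum j)
    + w x * (ln e - (ln (k%:R + 2^-1) + ln h) + harmonic_sum k)
    = w x * (euler_gap j - euler_gap k) by rewrite /euler_gap; ring.
  by rewrite normrM ler_pM// euler_gap_dist.
have T := le_trans (ler_normD _ _) (lerD (le_trans (ler_normD _ _) (lerD L U)) G).
apply: (le_trans _ (le_trans T _)); rewrite le_eqVlt; apply/orP; left; apply/eqP.
  by congr `|_|; ring.
by rewrite /pv_error; ring.
Qed.

(** * Consistency *)

(** Division by i swaps the two parts, which reduces the complex kernel to the real one 1/(x - y)
    acting on [Im u / pi] and [- Re u / pi]. *)
Lemma div_ipi (R : realType) (z : R[i]) (r : R) :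
  z / ('i%C * pi%:C * r%:C) =
  (complex.Im z / pi / r) +i* (- (complex.Re z / pi) / r).
Proof.
have iV : 'i%C^-1 = - 'i%C :> R[i].
  have i0 : 'i%C != 0 :> R[i] by rewrite eq_complex /= eqxx oner_eq0.
  by apply: (mulfI i0); rewrite divff// mulrN -expr2 sqr_i opprK.
rewrite -mulrA invfM iV -rmorphM -fmorphV /= invfM.
case: z => x y; move: pi^-1 r^-1 => p q.
by apply/eqP; rewrite eq_complex /=; apply/andP; split; apply/eqP; ring.
Qed.

Lemma Cintegral_div_ipi (R : realType) (D : set R) (u : R -> R[i]) (x : R) :
  Cintegral D (fun y => u y / ('i%C * pi%:C * (x - y)%:C)) =
  (\int[lebesgue_measure]_(y in D) (complex.Im (u y) / pi / (x - y)))
  +i* (\int[lebesgue_measure]_(y in D) (- (complex.Re (u y) / pi) / (x - y))).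
Proof.
by rewrite /Cintegral; congr (_ +i* _); apply: eq_Rintegral => y _; rewrite div_ipi.
Qed.

Lemma complex_sum (R : realType) (I : finType) (P : pred I) (F G : I -> R) :
  \sum_(i | P i) (F i +i* G i) = (\sum_(i | P i) F i) +i* (\sum_(i | P i) G i).
Proof. by elim/big_rec3: _ => [|i x y z _ ->]. Qed.

Lemma Re_le_normc (R : realType) (z : R[i]) : `|complex.Re z| <= cmod z.
Proof. by case: z => x y /=; rewrite -sqrtr_sqr ler_wsqrtr// lerDl sqr_ge0. Qed.

Lemma Im_le_normc (R : realType) (z : R[i]) : `|complex.Im z| <= cmod z.
Proof. by case: z => x y /=; rewrite -sqrtr_sqr ler_wsqrtr// lerDr sqr_ge0. Qed.

Lemma pv_limit_bound (R : realType) (D : set R) (x : R) (g : R -> R[i])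
    (v s : R[i]) (d B : R) : is_pv D x g v -> 0 < d ->
  (forall e, 0 < e < d -> let I := Cintegral [set y | D y /\ e < `|y - x|] g in
    `|complex.Re (I - s)| <= B /\ `|complex.Im (I - s)| <= B) ->
  `|complex.Re (v - s)| <= B /\ `|complex.Im (v - s)| <= B.
Proof.
move=> pv d0 H.
have K (eta : R) : 0 < eta ->
    `|complex.Re (v - s)| <= B + eta /\ `|complex.Im (v - s)| <= B + eta.
  move=> eta0.
  have etaC : 0 < eta%:C :> R[i] by rewrite ltcE /= eqxx.
  have N1 : \forall e \near 0^'+,
      `|(v : R[i]^o) - Cintegral [set y | D y /\ e < `|y - x|] g| < eta%:C.
    exact: (@cvgrPdist_lt R[i] R[i]^o _ _ _ _ _).1 pv _ etaC.
  have N2 : \forall e \near 0^'+, 0 < e < d.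
    near=> e; apply/andP; split; near: e; first exact: nbhs_right_gt.
    exact: nbhs_right_lt.
  have [e [/= He1 /H [HR HI]]] := filter_ex (filterI N1 N2).
  set I := Cintegral _ _ in He1 HR HI.
  have {}He1 : cmod (v - I) < eta.
    by move: He1; rewrite normc_def ltcR; case: (v - I).
  have R1 := Re_le_normc R (v - I); have I1 := Im_le_normc R (v - I).
  split.
    have -> : complex.Re (v - s) = complex.Re (I - s) + complex.Re (v - I).
      by case: (v) (I) (s) => ? ? [? ?] [? ?] /=; ring.
    by apply: le_trans (ler_normD _ _) _; lra.
  have -> : complex.Im (v - s) = complex.Im (I - s) + complex.Im (v - I).
    by case: (v) (I) (s) => ? ? [? ?] [? ?] /=; ring.
  by apply: le_trans (ler_normD _ _) _; lra.
split; apply/ler_addgt0Pr => eta /K [] //.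
Unshelve. all: by end_near. Qed.

Lemma midpointE (R : realType) (a : R) (N M : nat) (j : 'I_M) : (0 < N)%N ->
  midpoint a N j = a + j%:R * mesh_step R N + mesh_step R N / 2.
Proof.
by move=> N0; rewrite /midpoint -natr1; move: (mesh_step _ _) => h; field.
Qed.

Lemma consistency (R : realType) (alpha K W a b : R) (lambda : R[i])
    (u f : R -> R[i]) (N M : nat) :
  0 < alpha <= 1 ->
  (forall x y, cmod (u x - u y) <= K * `|x - y| `^ alpha) ->
  (forall x, cmod (u x) <= W) ->
  is_sie_solution a b lambda f u ->
  (0 < N)%N -> M%:R = N%:R * (b - a) -> forall j : 'I_M,
  let r := discrete_op lambda (fun n => u (midpoint a N n)) j - f (midpoint a N j) in
  let B := pv_error alpha (K / pi) (W / pi) (mesh_step R N) j (M.-1 - j) in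
  `|complex.Re r| <= B /\ `|complex.Im r| <= B.
Proof.
move=> a01 hu hW sol N0 MN j; have /andP[a0 a1] := a01.
set h := mesh_step R N; set x := midpoint a N j.
have h0 : 0 < h by rewrite invr_gt0 ltr0n.
have pi0 : 0 < pi :> R := pi_gt0 R.
(* Number of cells to the right of the cell of [x]; as [j] counts from 0, there are [j] cells to its
   left. *)
set k := (M.-1 - j)%N.
have Mk : M = (j + k.+1)%N by rewrite /k; have := ltn_ord j; lia.
have xE : x = a + j%:R * h + h / 2 by rewrite /x midpointE.
have bE : b = x + h / 2 + k%:R * h.
  have NM : b - a = M%:R * h.
    by rewrite MN /h /mesh_step mulrAC divff ?mul1r// pnatr_eq0 -lt0n.
  have MR : M%:R = j%:R + (k%:R + 1) :> R by rewrite natr1 -natrD -Mk.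
  by rewrite -[b](subrK a) NM xE MR; field.
have jh : 0 <= j%:R * h by rewrite mulr_ge0// ltW.
have kh : 0 <= k%:R * h by rewrite mulr_ge0// ltW.
have xab : x \in `]a, b[ by rewrite in_itv /= bE; apply/andP; split; rewrite ?xE; lra.
have [v [pv vE]] := sol x xab.
have ptE (n : 'I_M) : midpoint a N n = a + n%:R * h + h / 2 by rewrite midpointE.
pose S (w : R -> R) := \sum_(i < j) w (a + i%:R * h + h / 2) / (j%:R - i%:R)
       - \sum_(i < k) w (x + i.+1%:R * h) / i.+1%:R.
pose w1 y := complex.Im (u y) / pi.
pose w2 y := - (complex.Re (u y) / pi).
have SE (w : R -> R) : \sum_(n < M | n != j) w (midpoint a N n) / (j%:R - n%:R) = S w.
  pose F (i : nat) := w (a + i%:R * h + h / 2) / (j%:R - i%:R).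
  transitivity (\sum_(n < M | n != j) F n).
    by apply: eq_bigr => n _; rewrite ptE.
  have G (m : nat) (o : 'I_m) (F' : nat -> R) : m = (j + k.+1)%N -> o = j :> nat ->
      \sum_(n < m | n != o) F' n = \sum_(i < j) F' i + \sum_(i < k) F' (j + i.+1)%N.
    by move=> mE; move: o; rewrite mE => o; exact: big_ord_neq.
  rewrite (G M j F Mk erefl) /S /F -sumrN; congr (_ + _); apply: eq_bigr => i _.
  rewrite natrD opprD addrA subrr add0r invrN mulrN.
  by congr (- (w _ / _)); rewrite xE; ring.
(* The integral equation at [x] trades [lambda * u x - f x] for the principal value [v], so the
   residual is a pure quadrature error. *)
have rE : discrete_op lambda (fun n => u (midpoint a N n)) j - f x
    = v - ((S w1) +i* (S w2)).
  rewrite -vE /discrete_op -/x -!SE -complex_sum mulr_sumr.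
  have -> : \sum_(n < M | n != j) ('i%C * pi%:C)^-1 * (u (midpoint a N n) / (j%:R - n%:R)%:C)
      = \sum_(n < M | n != j) ((w1 (midpoint a N n) / (j%:R - n%:R)) +i*
         (w2 (midpoint a N n) / (j%:R - n%:R))).
    apply: eq_bigr => n _; rewrite -div_ipi mulrCA; congr (_ * _).
    by rewrite -invfM.
  by rewrite opprB addrC addrA subrK.
rewrite /= rE.
have Hw1 y z : `|w1 y - w1 z| <= K / pi * `|y - z| `^ alpha.
  rewrite /w1 -mulrBl normrM normfV (gtr0_norm pi0).
  rewrite mulrAC ler_wpM2r ?invr_ge0 ?(ltW pi0)//.
  apply: le_trans (hu y z); apply: le_trans (Im_le_normc _ _).
  by case: (u y) (u z) => ? ? [? ?].
have Hw2 y z : `|w2 y - w2 z| <= K / pi * `|y - z| `^ alpha.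
  rewrite /w2 -opprD normrN -mulrBl normrM normfV (gtr0_norm pi0).
  rewrite mulrAC ler_wpM2r ?invr_ge0 ?(ltW pi0)//.
  apply: le_trans (hu y z); apply: le_trans (Re_le_normc _ _).
  by case: (u y) (u z) => ? ? [? ?].
have B1 : `|w1 x| <= W / pi.
  rewrite /w1 normrM normfV (gtr0_norm pi0) ler_wpM2r ?invr_ge0 ?(ltW pi0)//.
  by apply: le_trans (hW x); exact: Im_le_normc.
have B2 : `|w2 x| <= W / pi.
  rewrite /w2 normrN normrM normfV (gtr0_norm pi0) ler_wpM2r ?invr_ge0 ?(ltW pi0)//.
  by apply: le_trans (hW x); exact: Re_le_normc.
have h2 : 0 < h / 2 by rewrite divr_gt0.
(* Cutoffs below [h / 2] stay inside the cell of [x]. *)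
apply: (pv_limit_bound _ _ _ _ _ _ _ _ pv h2) => e eh I.
rewrite {}/I Cintegral_div_ipi /=.
by split; apply: truncated_pv_estimate.
Qed.

(** * Norm estimates *)

(** Control on open cells suffices, since endpoints are null sets. They must be avoided:
    neighbouring closed mesh cells share an endpoint, where [piecewise_constant] adds both
    values. *)
Lemma integral_le_cells (R : realType) (g : R -> R) (a h : R) (c : nat -> R) (M : nat) :
  measurable_fun setT g -> (forall x, 0 <= g x) -> 0 < h ->
  (forall k x, (k < M)%N -> x \in `]a + k%:R * h, a + k.+1%:R * h[ -> g x <= c k) ->
  (\int[lebesgue_measure]_(x in `]a, (a + M%:R * h)%R]) (g x)%:E
   <= (\sum_(k < M) c k * h)%R%:E)%E.
Proof.
move=> mg g0 h0; elim: M => [|M IH] H.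
  rewrite mul0r addr0 set_itv_ge ?integral_set0 ?big_ord0//.
  by rewrite bnd_simp ltxx.
have mgE (D : set R) : measurable_fun D (EFin \o g).
  by apply/measurable_EFinP; exact: measurable_funS mg.
have lM : a <= a + M%:R * h by rewrite lerDl mulr_ge0// ltW.
have lS : a + M%:R * h < a + M.+1%:R * h by rewrite ltrD2l ltr_pM2r// ltr_nat.
rewrite (@itv_bndbnd_setU _ _ _ (BRight (a + M%:R * h))); last 2 first.
- by rewrite bnd_simp.
- by rewrite bnd_simp ltW.
rewrite ge0_integral_setU//=; last 3 first.
- exact: mgE.
- by move=> x _; rewrite lee_fin.
- apply/disj_setPS => x /= []; rewrite !in_itv /= => /andP[_ h1] /andP[h2 _].
  by move: (le_lt_trans h1 h2); rewrite ltxx.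
rewrite big_ord_recr /= EFinD; apply: leeD.
  by apply: IH => k x kM; apply: H; rewrite ltnS ltnW.
rewrite -integral_itv_bndo_bndc; last exact: mgE.
apply: le_trans (_ : \int[lebesgue_measure]_(x in `](a + M%:R * h)%R, (a + M.+1%:R * h)%R[)
   (cst (c M)%:E x) <= _)%E.
  apply: ge0_le_integral => //=.
  - by move=> x _; rewrite lee_fin.
  - exact: mgE.
  - by move=> x xI; rewrite lee_fin; apply: (H M x).
rewrite integral_cst//= lebesgue_measure_itv /= lte_fin lS -EFinB -EFinM lee_fin.
by rewrite le_eqVlt; apply/orP; left; apply/eqP; rewrite -natr1; ring.
Qed.

Lemma L2norm_le (R : realType) (a b B : R) (e : R -> R[i]) : 0 <= B ->
  (\int[lebesgue_measure]_(x in `]a, b[) (cmod (e x) ^+ 2)%:E <= (B ^+ 2)%:E)%E ->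
  (L2norm a b e <= B%:E)%E.
Proof.
move=> B0 H; rewrite /L2norm unlock /Lnorm.
have -> : (\int[lebesgue_measure]_x
      `|((fun x => (cmod (e x))%:E) \_ `]a, b[%classic) x| `^ 2
    = \int[lebesgue_measure]_(x in `]a, b[) (cmod (e x) ^+ 2)%:E)%E.
  rewrite [RHS]integral_mkcond; apply: eq_integral => x _.
  rewrite !patchE; case: ifP => _ /=.
    by rewrite ger0_norm ?normc_ge0// powR_mulrn// normc_ge0.
  by rewrite normr0 powR0.
apply: le_trans (_ : (B ^+ 2)%:E `^ 2^-1 <= _)%E.
  apply: gt0_ler_poweR => //.
  - by rewrite in_itv /= integral_ge0 ?leey// => x _; rewrite lee_fin sqr_ge0.
  - by rewrite in_itv /= lee_fin sqr_ge0 leey.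
by rewrite poweR_EFin powR12_sqrt ?sqr_ge0// sqrtr_sqr ger0_norm.
Qed.

Lemma measurable_normc (R : realType) (f : R -> R[i]) :
  measurable_fun setT (fun x => complex.Re (f x)) ->
  measurable_fun setT (fun x => complex.Im (f x)) ->
  measurable_fun setT (fun x => cmod (f x)).
Proof.
move=> mR mI.
rewrite (_ : (fun x => _) = (@Num.sqrt R) \o
    (fun x => complex.Re (f x) ^+ 2 + complex.Im (f x) ^+ 2)); last first.
  by apply/funext => x /=; case: (f x).
apply: measurableT_comp.
  by apply: continuous_measurable_fun; exact: sqrt_continuous.
by apply: measurable_funD; apply: measurable_funX.
Qed.

Lemma piecewise_constantE (R : realType) (a : R) (N M : nat) (U : 'cV[R[i]]_M) (x : R) :
  piecewise_constant a N U x =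
  (\sum_(k < M) complex.Re (U k 0) * \1_(mesh_cell a N k) x) +i*
  (\sum_(k < M) complex.Im (U k 0) * \1_(mesh_cell a N k) x).
Proof.
rewrite /piecewise_constant -complex_sum; apply: eq_bigr => k _.
case: (U k 0) => p q /=; move: (\1_ _ _) => r.
by apply/eqP; rewrite eq_complex /=; apply/andP; split; apply/eqP; ring.
Qed.

Lemma measurable_error (R : realType) (a : R) (N M : nat) (U : 'cV[R[i]]_M)
    (u : R -> R[i]) :
  continuous (fun x => complex.Re (u x)) -> continuous (fun x => complex.Im (u x)) ->
  measurable_fun setT (fun x => cmod (u x - piecewise_constant a N U x)).
Proof.
move=> cR cI; apply: measurable_normc.
  rewrite (_ : (fun x => _) = (fun x => complex.Re (u x) -
      \sum_(k < M) complex.Re (U k 0) * \1_(mesh_cell a N k) x)); last first.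
    by apply/funext => x; rewrite piecewise_constantE; case: (u x).
  apply: measurable_funB; first exact: continuous_measurable_fun.
  apply: measurable_sum => k; apply: measurable_funM => //.
  by apply: measurable_indic; exact: measurable_itv.
rewrite (_ : (fun x => _) = (fun x => complex.Im (u x) -
    \sum_(k < M) complex.Im (U k 0) * \1_(mesh_cell a N k) x)); last first.
  by apply/funext => x; rewrite piecewise_constantE; case: (u x).
apply: measurable_funB; first exact: continuous_measurable_fun.
apply: measurable_sum => k; apply: measurable_funM => //.
by apply: measurable_indic; exact: measurable_itv.
Qed.

Lemma piecewise_constant_cell (R : realType) (a : R) (N M : nat)
    (U : 'cV[R[i]]_M) (k : 'I_M) (x : R) : (0 < N)%N ->
  x \in `]a + k%:R * mesh_step R N, a + k.+1%:R * mesh_step R N[ ->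
  piecewise_constant a N U x = U k 0.
Proof.
move=> N0; set h := mesh_step R N; rewrite in_itv /= -natr1 => /andP[x1 x2].
have h0 : 0 < h by rewrite invr_gt0 ltr0n.
rewrite /piecewise_constant (bigD1 k) //= big1 ?addr0 => [|n nk].
  rewrite indicE mem_set ?mulr1// /mesh_cell /= in_itv /= midpointE// -/h.
  by apply/andP; split; lra.
rewrite indicE memNset ?mulr0// /mesh_cell /= in_itv /= midpointE// -/h.
move=> /andP[h1 h2]; move: nk; rewrite -val_eqE /= neq_ltn => /orP[nk|nk].
  have : (n%:R + 1) * h <= k%:R * h by rewrite ler_wpM2r ?(ltW h0)// natr1 ler_nat.
  by lra.
have : (k%:R + 1) * h <= n%:R * h by rewrite ler_wpM2r ?(ltW h0)// natr1 ler_nat.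
by lra.
Qed.

Lemma pv_error_ge0 (R : realType) (alpha K W h : R) (j k : nat) :
  0 < alpha -> 0 <= K -> 0 <= W -> 0 <= pv_error alpha K W h j k.
Proof.
move=> a0 K0 W0; have V (i : nat) : 0 <= i.+1%:R^-1 :> R by rewrite invr_ge0.
have P := powR_ge0 h alpha; have P2 := powR_ge0 (h / 2) alpha.
have Hj := harmonic_sum_ge0 R j; have Hk := harmonic_sum_ge0 R k.
by rewrite !addr_ge0 ?mulr_ge0 ?addr_ge0 ?invr_ge0 ?(ltW a0).
Qed.

(** In [6 * K] two harmonic sums, each at most [1 + ln M], meet the factor [3 * K]; [2 * K / alpha]
    stems from the two half cells. The 64 is 16 times the bound 2 + 2 for the two sums of inverse
    squares, and they stay bounded in [M], which leaves a full factor [h]. *)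
Lemma pv_error_l2 (R : realType) (alpha K W h : R) (M : nat) :
  0 < alpha <= 1 -> 0 <= K -> 0 <= W -> 0 < h -> (0 < M)%N ->
  h * \sum_(j < M) pv_error alpha K W h j (M.-1 - j) ^+ 2
  <= 2 * (6 * K + 2 * K / alpha) ^+ 2 * (M%:R * h) * (h `^ alpha * (1 + ln M%:R)) ^+ 2
     + 64 * W ^+ 2 * h.
Proof.
move=> /andP[a0 a1] K0 W0 h0 M0.
set A := 6 * K + 2 * K / alpha; set L := 1 + ln M%:R; set Q := h `^ alpha * L.
have A0 : 0 <= A by rewrite addr_ge0 ?mulr_ge0 ?invr_ge0 ?(ltW a0).
have L1 : 1 <= L by rewrite lerDl ln_ge0// ler1n.
have ha0 := powR_ge0 h alpha.
have V (i : nat) : 0 <= i.+1%:R^-1 :> R by rewrite invr_ge0.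
have P_le (j : 'I_M) : pv_error alpha K W h j (M.-1 - j)
    <= A * Q + 2 * W * (j.+1%:R^-1 + (rev_ord j).+1%:R^-1).
  (* Both sides equal [M - j]; with [rev_ord], the sum of inverse squares on the right becomes a
     reindexing of the one on the left. *)
  have -> : (rev_ord j).+1 = (M.-1 - j).+1 by rewrite /=; have := ltn_ord j; lia.
  rewrite /pv_error; apply: lerD; last by rewrite mulrA (mulrC W).
  rewrite /A (mulrDl _ _ Q); apply: lerD.
    rewrite /Q mulrA [6 * K * _](_ : _ = 3 * K * h `^ alpha * 2); last by ring.
    rewrite -[leRHS]mulrA ler_wpM2l ?mulr_ge0//.
    have H1 := @harmonic_sum_le R j M (ltnW (ltn_ord j)) M0.
    have jM : (M.-1 - j <= M)%N by rewrite (leq_trans (leq_subr _ _))// leq_pred.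
    by have := harmonic_sum_le R _ _ jM M0; rewrite -/L in H1 *; lra.
  rewrite mulrAC ler_wpM2l ?mulr_ge0 ?invr_ge0 ?(ltW a0)//.
  apply: le_trans (_ : h `^ alpha <= _); last by rewrite /Q ler_peMr.
  have h2 : h / 2 <= h by lra.
  by rewrite ge0_ler_powR ?nnegrE ?(ltW a0) ?divr_ge0 ?(ltW h0).
rewrite mulr_sumr.
apply: le_trans (_ : \sum_(j < M) (2 * A ^+ 2 * Q ^+ 2 * h
    + (16 * W ^+ 2 * h) * (j.+1%:R^-1 ^+ 2 + (rev_ord j).+1%:R^-1 ^+ 2)) <= _).
  apply: ler_sum => j _.
  set x := j.+1%:R^-1; set y := (rev_ord j).+1%:R^-1.
  apply: le_trans (_ : h * (A * Q + 2 * W * (x + y)) ^+ 2 <= _).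
    rewrite ler_wpM2l ?(ltW h0)// ler_pXn2r ?nnegrE ?P_le// ?pv_error_ge0//.
    by apply: le_trans (P_le j); rewrite pv_error_ge0.
  rewrite -subr_ge0.
  (* Two uses of [(s + t)^2 <= 2 s^2 + 2 t^2], with the slack written as explicit squares. *)
  have -> : 2 * A ^+ 2 * Q ^+ 2 * h + 16 * W ^+ 2 * h * (x ^+ 2 + y ^+ 2)
      - h * (A * Q + 2 * W * (x + y)) ^+ 2
    = h * ((A * Q - 2 * W * (x + y)) ^+ 2 + 8 * (W * (x - y)) ^+ 2) by ring.
  by rewrite pmulr_rge0// addr_ge0 ?sqr_ge0// pmulr_rge0// sqr_ge0.
rewrite big_split /= sumr_const card_ord -mulr_sumr big_split /=.
have S1 := sum_inv_sqr_le2 R M.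
have S2 : \sum_(j < M) ((rev_ord j).+1%:R^-1) ^+ 2 <= 2 :> R.
  apply: le_trans S1; rewrite [leRHS](reindex_inj rev_ord_inj) /=.
  by [].
apply: lerD.
  by rewrite -mulr_natr le_eqVlt; apply/orP; left; apply/eqP; ring.
have -> : 64 * W ^+ 2 * h = 16 * W ^+ 2 * h * 4 by ring.
by rewrite ler_wpM2l ?mulr_ge0 ?sqr_ge0 ?(ltW h0)//; lra.
Qed.

(** Nearest-point projection onto [a, b]. Being 1-Lipschitz, it extends [u] to the whole line by its
    endpoint values with the Hoelder condition preserved, so the estimates above can assume it
    everywhere. *)
Definition clamp {R : realType} (a b x : R) : R := Num.max a (Num.min b x).

Lemma clamp_id (R : realType) (a b x : R) : x \in `[a, b] -> clamp a b x = x.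
Proof.
by rewrite in_itv /= /clamp => /andP[ax xb]; rewrite min_r// max_r.
Qed.

Lemma clamp_itv (R : realType) (a b x : R) : a <= b -> clamp a b x \in `[a, b].
Proof. by move=> ab; rewrite in_itv /= /clamp le_max lexx ge_max ab ge_min lexx. Qed.

Lemma clamp_dist (R : realType) (a b x y : R) : a <= b ->
  `|clamp a b x - clamp a b y| <= `|x - y|.
Proof.
move=> ab; wlog xy : x y / x <= y.
  by move=> W; have [/W//|/ltW /W] := leP x y; rewrite distrC (distrC y).
rewrite [leRHS]distrC (ger0_norm (_ : 0 <= y - x)) ?subr_ge0// /clamp.
have [xb|xb] := leP b x; have [yb|yb] := leP b y;
  have [ax|ax] := leP a x; have [ay|ay] := leP a y;
  rewrite ?(max_r ab) ?(max_r ax) ?(max_r ay) ?(max_l (ltW ax)) ?(max_l (ltW ay));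
  by rewrite ler_norml; apply/andP; split; lra.
Qed.

(** Only values in the open interval enter the equation, so the clamped extension solves it with the
    same [f]. *)
Lemma sie_solution_ext (R : realType) (a b : R) (lambda : R[i]) (f u v : R -> R[i]) :
  (forall x, x \in `]a, b[ -> u x = v x) ->
  is_sie_solution a b lambda f u -> is_sie_solution a b lambda f v.
Proof.
move=> uv sol x xab; have [z [pv zE]] := sol x xab; exists z.
split; last by rewrite -uv.
move: pv; rewrite /is_pv.
under eq_fun => eps.
  rewrite Cintegral_div_ipi.
  under eq_Rintegral => y.
    rewrite inE /= => -[/uv -> _].
    over.
  under [X in _ +i* X]eq_Rintegral => y.
    rewrite inE /= => -[/uv -> _].
    over.
  rewrite -Cintegral_div_ipi.
  over.
by [].
Qed.

Lemma L2norm_ext (R : realType) (a b : R) (e1 e2 : R -> R[i]) :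
  (forall x, x \in `]a, b[ -> e1 x = e2 x) -> L2norm a b e1 = L2norm a b e2.
Proof.
move=> E; rewrite /L2norm; congr (Lnorm _ _ _); apply/funext => x.
by rewrite !patchE; case: ifPn => //; rewrite inE => /= /E ->.
Qed.

Lemma discrete_op_sub (R : realType) (lambda : R[i]) (M : nat)
    (E F : 'I_M -> R[i]) (j : 'I_M) :
  discrete_op lambda (fun n => E n - F n) j = discrete_op lambda E j - discrete_op lambda F j.
Proof.
rewrite /discrete_op.
under eq_bigr => n _ do rewrite mulrBl.
by rewrite sumrB !mulrBr; ring.
Qed.

(** On the k-th cell the error is [u - u(x_k)], at most [K h^alpha], plus the nodal error [E k],
    which stability controls by the residual. Of the factor 4, one 2 comes from squaring this sum
    and one from bounding real and imaginary parts of the residual separately. *)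
Lemma error_bound (R : realType) (alpha K W d a b : R) (lambda : R[i])
    (u f : R -> R[i]) (N M : nat) (U : 'cV[R[i]]_M) :
  0 < alpha <= 1 -> 0 <= K -> 0 <= W -> 0 < d -> a < b ->
  (forall t : R, -1 <= t <= 1 -> d <= cmod (lambda - t%:C)) ->
  (forall x y, cmod (u x - u y) <= K * `|x - y| `^ alpha) ->
  (forall x, cmod (u x) <= W) ->
  is_sie_solution a b lambda f u ->
  (0 < N)%N -> (0 < M)%N -> M%:R = N%:R * (b - a) ->
  is_discrete_solution a lambda f N U ->
  let h := mesh_step R N in
  let A := 6 * (K / pi) + 2 * (K / pi) / alpha in
  (L2norm a b (fun x => u x - piecewise_constant a N U x)%R <=
  (Num.sqrt (2 * K ^+ 2 * (b - a) + 4 * (2 * A ^+ 2 * (b - a) + 64 * (W / pi) ^+ 2) / d ^+ 2)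
   * (h `^ alpha * (1 + ln M%:R) + Num.sqrt h))%:E)%E.
Proof.
move=> a01 K0 W0 d0 ab hd hu hW sol N0 M0 MN HU; cbv zeta.
set h := mesh_step R N; set A := _ + 2 * (K / pi) / alpha; have /andP[a0 a1] := a01.
have h0 : 0 < h by rewrite invr_gt0 ltr0n.
have pi0 : 0 < pi :> R := pi_gt0 R.
have ba : M%:R * h = b - a.
  by rewrite MN /h /mesh_step mulrAC divff ?mul1r// pnatr_eq0 -lt0n.
have ba0 : 0 < b - a by rewrite subr_gt0.
set L := 1 + ln M%:R; set q := h `^ alpha * L.
have L1 : 1 <= L by rewrite lerDl ln_ge0// ler1n.
have q0 : 0 <= q by rewrite mulr_ge0 ?powR_ge0// (le_trans _ L1).
pose E (j : 'I_M) := u (midpoint a N j) - U j 0.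
pose r (j : 'I_M) := discrete_op lambda (fun n => u (midpoint a N n)) j - f (midpoint a N j).
have Er j : discrete_op lambda E j = r j.
  rewrite discrete_op_sub /r; congr (_ - _).
  exact: (discrete_solutionP _ _ _ _ _ _ _ N0).1.
have stab := discrete_stability R lambda d M E r d0 hd Er.
have Kp : 0 <= K / pi by rewrite divr_ge0// ltW.
have Wp : 0 <= W / pi by rewrite divr_ge0// ltW.
have rP : h * \sum_(j < M) cmod (r j) ^+ 2
    <= 2 * (2 * A ^+ 2 * (b - a) * q ^+ 2 + 64 * (W / pi) ^+ 2 * h).
  have l2 := pv_error_l2 R alpha _ _ h M a01 Kp Wp h0 M0.
  rewrite -ba; apply: le_trans (ler_wpM2l (ler0n _ 2) l2).
  rewrite mulrCA ler_wpM2l ?(ltW h0)// mulr_sumr; apply: ler_sum => j _.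
  have [c1 c2] := consistency R alpha K W a b lambda u f N M a01 hu hW sol N0 MN j.
  have P0 := pv_error_ge0 R alpha (K / pi) (W / pi) h j (M.-1 - j) a0 Kp Wp.
  rewrite normc_sqr mulr2n mulrDl !mul1r.
  rewrite -(real_normK (num_real (complex.Re _))) -(real_normK (num_real (complex.Im _))).
  by apply: lerD; rewrite ler_pXn2r// nnegrE.
have EP : h * \sum_(j < M) cmod (E j) ^+ 2
    <= 2 * (2 * A ^+ 2 * (b - a) * q ^+ 2 + 64 * (W / pi) ^+ 2 * h) / d ^+ 2.
  rewrite ler_pdivlMr ?exprn_gt0//; apply: le_trans rP.
  by rewrite -mulrA ler_wpM2l ?(ltW h0)// mulrC.
set Q := 2 * K ^+ 2 * (b - a) + 4 * (2 * A ^+ 2 * (b - a) + 64 * (W / pi) ^+ 2) / d ^+ 2.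
have T1 : 0 <= 2 * K ^+ 2 * (b - a) by rewrite pmulr_lge0// pmulr_rge0// sqr_ge0.
have T2 : 0 <= 2 * A ^+ 2 * (b - a) by rewrite pmulr_lge0// pmulr_rge0// sqr_ge0.
have T3 : 0 <= 64 * (W / pi) ^+ 2 by rewrite pmulr_rge0// sqr_ge0.
have dV : 0 <= d ^- 2 by rewrite invr_ge0 sqr_ge0.
have Q0 : 0 <= Q by rewrite addr_ge0// mulr_ge0// mulr_ge0// addr_ge0.
apply: L2norm_le.
  by rewrite mulr_ge0 ?sqrtr_ge0// addr_ge0// sqrtr_ge0.
pose g x := cmod (u x - piecewise_constant a N U x) ^+ 2.
(* The cell bounds are indexed by [nat]; the default 0 is never reached for [k < M]. *)
pose c (k : nat) := 2 * K ^+ 2 * (h `^ alpha) ^+ 2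
  + 2 * (if insub k is Some j then cmod (E j) ^+ 2 else 0).
have cR : continuous (fun x => complex.Re (u x)).
  apply: (hoelder_continuous R alpha K _ a0) => x y; apply: le_trans (hu x y).
  by apply: le_trans (Re_le_normc _ _); case: (u x) (u y) => ? ? [? ?].
have cI : continuous (fun x => complex.Im (u x)).
  apply: (hoelder_continuous R alpha K _ a0) => x y; apply: le_trans (hu x y).
  by apply: le_trans (Im_le_normc _ _); case: (u x) (u y) => ? ? [? ?].
have mg : measurable_fun setT g.
  by apply: measurable_funX; exact: measurable_error.
have g0 x : 0 <= g x by rewrite sqr_ge0.
have gc k x : (k < M)%N -> x \in `]a + k%:R * h, a + k.+1%:R * h[ -> g x <= c k.
  move=> kM xI; rewrite /g /c insubT /=.
  rewrite (@piecewise_constant_cell _ _ _ _ _ (Ordinal kM))//.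
  set j := Ordinal kM.
  have e1 : cmod (u x - U j 0) <= K * h `^ alpha + cmod (E j).
    have -> : u x - U j 0 = (u x - u (midpoint a N j)) + E j.
      by rewrite /E addrA subrK.
    apply: le_trans (le_normcD _ _) _; apply: lerD => //.
    apply: le_trans (hu _ _) _; rewrite ler_wpM2l// ge0_ler_powR ?nnegrE ?(ltW a0) ?(ltW h0)//.
    move: xI; rewrite in_itv /= midpointE// -/h -natr1 => /andP[x1 x2].
    by rewrite ler_norml; apply/andP; split; lra.
  apply: le_trans (_ : (K * h `^ alpha + cmod (E j)) ^+ 2 <= _).
    rewrite ler_pXn2r// nnegrE ?normc_ge0//.
    by rewrite addr_ge0 ?normc_ge0// mulr_ge0// powR_ge0.
  rewrite -subr_ge0.
  have -> : 2 * K ^+ 2 * (h `^ alpha) ^+ 2 + 2 * cmod (E j) ^+ 2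
      - (K * h `^ alpha + cmod (E j)) ^+ 2
    = (K * h `^ alpha - cmod (E j)) ^+ 2 by ring.
  exact: sqr_ge0.
have main := @integral_le_cells R g a h c M mg g0 h0 gc.
apply: le_trans (_ : _ <= \int[lebesgue_measure]_(x in `]a, b]) (g x)%:E)%E _.
  apply: ge0_subset_integral => //=.
  - by apply/measurable_EFinP; exact: measurable_funS mg.
  - by move=> x _; rewrite lee_fin sqr_ge0.
  - by move=> x /=; rewrite !in_itv /= => /andP[-> /ltW ->].
have {1}-> : b = a + M%:R * h by rewrite ba addrC subrK.
apply: le_trans main _; rewrite lee_fin.
have -> : \sum_(k < M) c k * h
    = 2 * K ^+ 2 * (b - a) * (h `^ alpha) ^+ 2 + 2 * (h * \sum_(j < M) cmod (E j) ^+ 2).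
  rewrite -ba -mulr_suml big_split /= sumr_const card_ord -mulr_natr -mulr_sumr.
  under [in LHS]eq_bigr => j _ do rewrite valK.
  by ring.
(* As [L >= 1], the interpolation error is dominated by the consistency error. *)
have hq : (h `^ alpha) ^+ 2 <= q ^+ 2.
  by rewrite ler_pXn2r ?nnegrE ?powR_ge0// ler_peMr// powR_ge0.
have S1 := ler_wpM2l T1 hq.
have S2 := ler_wpM2l (ler0n R 2) EP.
apply: le_trans (lerD S1 S2) _.
rewrite [leRHS]exprMn sqr_sqrtr//.
have sh : Num.sqrt h ^+ 2 = h by rewrite sqr_sqrtr// ltW.
have s0 := sqrtr_ge0 h.
rewrite -subr_ge0 /Q; move: (q) (2 * K ^+ 2 * (b - a)) (2 * A ^+ 2 * (b - a))
  (64 * (W / pi) ^+ 2) (d ^- 2) q0 T1 T2 T3 dV => p k1 k2 k3 k4 p0 T1 T2 T3 dV.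
move: (Num.sqrt h) sh s0 => s <- s0.
have -> : (k1 + 4 * (k2 + k3) * k4) * (p + s) ^+ 2
   - (k1 * p ^+ 2 + 2 * (2 * (k2 * p ^+ 2 + k3 * s ^+ 2) * k4))
  = k1 * (s ^+ 2 + 2 * p * s) + 4 * k2 * k4 * (s ^+ 2 + 2 * p * s)
    + 4 * k3 * k4 * (p ^+ 2 + 2 * p * s) by ring.
by rewrite !addr_ge0// ?mulr_ge0 ?addr_ge0 ?mulr_ge0 ?sqr_ge0.
Qed.

Theorem theorem3p4 (R : realType) (a b : R) (hab : a < b)
    (lambda : R[i]) (hlambda : forall t : R, t \in `[-1, 1] -> lambda <> t%:C)
    (alpha : R) (halpha : 0 < alpha <= 1)
    (u f : R -> R[i]) (hu : hoelder_on alpha a b u)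
    (hsol : is_sie_solution a b lambda f u) :
  exists C : R, forall N M : nat,
    (0 < N)%N -> (0 < M)%N -> M%:R = N%:R * (b - a) ->
    (exists! U : 'cV[R[i]]_M, is_discrete_solution a lambda f N U) /\
    (forall U : 'cV[R[i]]_M, is_discrete_solution a lambda f N U ->
       (L2norm a b (fun x => u x - piecewise_constant a N U x)%R
        <= (C * (N%:R `^ (- alpha) * ln N%:R + N%:R `^ (- 2^-1)))%:E)%E).
Proof.
have /andP[a0 a1] := halpha.
have [d d0 hd] := resolvent_dist R lambda hlambda.
have [K hK] := hu.
have ab := ltW hab.
pose v x := u (clamp a b x).
have vE x : x \in `]a, b[ -> u x = v x.
  rewrite in_itv /= /v => /andP[ax xb].
  by rewrite clamp_id// in_itv /= !ltW.
have hv x y : cmod (v x - v y) <= `|K| * `|x - y| `^ alpha.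
  apply: le_trans (hK _ _ (clamp_itv _ _ _ _ ab) (clamp_itv _ _ _ _ ab)) _.
  apply: le_trans (_ : `|K| * `|clamp a b x - clamp a b y| `^ alpha <= _).
    by rewrite ler_wpM2r ?powR_ge0 ?ler_norm.
  by rewrite ler_wpM2l// ge0_ler_powR ?nnegrE ?(ltW a0)// clamp_dist.
(* Every clamped point is within [b - a] of [a], so the Hoelder condition yields a supremum
   bound. *)
pose W := cmod (v a) + `|K| * (b - a) `^ alpha.
have hW x : cmod (v x) <= W.
  have -> : v x = v a + (v (clamp a b x) - v a).
    by rewrite addrC subrK /v (clamp_id R a b (clamp a b x)) ?clamp_itv.
  apply: le_trans (le_normcD _ _) _; rewrite lerD2l.
  apply: le_trans (hv _ _) _; rewrite ler_wpM2l// ge0_ler_powR ?nnegrE ?subr_ge0 ?(ltW a0)//.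
  have := clamp_itv R a b x ab; rewrite in_itv /= => /andP[c1 c2].
  by rewrite ger0_norm ?subr_ge0// lerB.
have W0 : 0 <= W by exact: le_trans (normc_ge0 _ _) (hW a).
have vsol := sie_solution_ext R a b lambda f u v vE hsol.
pose A := 6 * (`|K| / pi) + 2 * (`|K| / pi) / alpha.
pose C0 := Num.sqrt (2 * `|K| ^+ 2 * (b - a)
  + 4 * (2 * A ^+ 2 * (b - a) + 64 * (W / pi) ^+ 2) / d ^+ 2).
pose c := `|ln (b - a)|.
have l2 : 0 < ln 2 :> R by rewrite ln_gt0// ltr1n.
(* From M = N (b - a), [1 + ln M] is at most [1 + c + ln N]. The constant [1 + c] is then absorbed
   at the cost of [(1 + c) / ln 2] in the logarithmic term and [1 + c] in the square-root term. *)
exists (C0 * (2 + c + (1 + c) / ln 2)) => N M N0 M0 MN; split.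
  have [U [HU HUu]] := discrete_exists R lambda d M (fun j => f (midpoint a N j)) d0 hd.
  exists U; split; first exact: (discrete_solutionP R a lambda f N M U N0).2.
  by move=> V HV; apply: HUu; exact: (discrete_solutionP R a lambda f N M V N0).1.
move=> U HU.
rewrite (@L2norm_ext _ _ _ _ (fun x => v x - piecewise_constant a N U x)); last first.
  by move=> x /vE ->.
have := error_bound R alpha `|K| W d a b lambda v f N M U halpha (normr_ge0 K) W0 d0 hab
  hd hv hW vsol N0 M0 MN HU.
move=> /= H; apply: le_trans H _; rewrite lee_fin -/A -/C0 -mulrA.
rewrite ler_wpM2l ?sqrtr_ge0//.
have NR : 0 < N%:R :> R by rewrite ltr0n.
have ba0 : 0 < b - a by rewrite subr_gt0.
have -> : mesh_step R N `^ alpha = N%:R `^ (- alpha).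
  by rewrite /mesh_step -[N%:R^-1]powR_inv1 ?(ltW NR)// -powRrM mulN1r.
have -> : Num.sqrt (mesh_step R N) = N%:R `^ (- 2^-1).
  rewrite -powR12_sqrt ?invr_ge0 ?(ltW NR)//.
  by rewrite /mesh_step -[N%:R^-1]powR_inv1 ?(ltW NR)// -powRrM mulN1r.
set p := _ `^ (- alpha); set s := _ `^ (- 2^-1).
have p0 : 0 <= p by rewrite powR_ge0.
have s0 : 0 <= s by rewrite powR_ge0.
have c0 : 0 <= c by rewrite normr_ge0.
have lN0 : 0 <= ln N%:R :> R by rewrite ln_ge0// ler1n.
have LM : 1 + ln M%:R <= 1 + c + ln N%:R.
  by rewrite MN lnM ?posrE//; have := ler_norm (ln (b - a)); rewrite -/c; lra.
(* For [N >= 2] the logarithm is at least [ln 2]; for [N = 1] it vanishes, and [s = p = 1] carries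
   the bound. *)
have PL : p <= p * ln N%:R / ln 2 + s.
  have [N1|N1] := leqP N 1.
    have {N1} NE : N = 1%N by apply/eqP; rewrite eqn_leq N1 N0.
    by rewrite /p /s NE !powR1 ln1 mulr0 mul0r add0r.
  apply: ler_wpDr => //; rewrite -mulrA ler_peMr//.
  by rewrite ler_pdivlMr// mul1r ler_ln ?posrE// ler_nat.
have i2 : 0 <= (ln 2)^-1 :> R by rewrite invr_ge0 ltW.
apply: le_trans (_ : p * (1 + c + ln N%:R) + s <= _).
  by rewrite lerD2r ler_wpM2l.
have c1 : 0 <= 1 + c by rewrite addr_ge0.
have := ler_wpM2l c1 PL; rewrite -subr_ge0 => PL'.
rewrite -subr_ge0; apply: le_trans PL' _; rewrite -subr_ge0.
move: (ln N%:R) (ln 2)^-1 i2 lN0 {LM PL} => l i i0 l0.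
have -> : (2 + c + (1 + c) * i) * (p * l + s) - (p * (1 + c + l) + s)
    - ((1 + c) * (p * l * i + s) - (1 + c) * p)
  = (1 + c) * (p * l) + (1 + c) * i * s by ring.
by rewrite addr_ge0 ?mulr_ge0.
Qed.
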